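(* Let $A$ be a finite set with $N\ge 2$ elements and let $\Omega$ be the set of Llull matrices $v=(v_{xy})$ on $A$. (1) For every ordered pair $xy$ of distinct elements of $A$, the projected score $v^\pi_{xy}$ is a continuous function of $v\in\Omega$. (2) For every $x\in A$, the rank-like rate $r_x$ is a continuous function of $v\in\Omega$. (3) For every fixed $f\in(0,1]$ and every $x\in A$, the fraction-like rate $\varphi_x$ is a continuous function of $v\in\Omega\setminus\{0\}$.
   Context: Let $A$ be a finite set with $N$ elements and $\Pi$ the set of ordered pairs $xy$ with $x,y\in A$, $x\ne y$. A relation on $A$ is a subset of $\Pi$. A Llull matrix on $A$ is a family $v=(v_{xy})_{xy\in\Pi}$ with $v_{xy}\in[0,1]$ and $v_{xy}+v_{yx}\le1$; $\Omega\subset\mathbb{R}^{\Pi}$ is the set of them. Turnovers: $t_{xy}=v_{xy}+v_{yx}$. Indirect scores: $v^*_{xy}=\max\min_{0\le i<n}v_{x_ix_{i+1}}$, the max being over all paths $x_0x_1\dots x_n$ ($n\ge1$, consecutive elements distinct) with $x_0=x$, $x_n=y$. Put $m^\nu_{xy}=v^*_{xy}-v^*_{yx}$, $\nu=\{xy\in\Pi: m^\nu_{xy}>0\}$, $\hat\nu=\{xy\in\Pi: m^\nu_{xy}\ge0\}$. An admissible order is a (strict) total order $\xi\subseteq\Pi$ with $\nu\subseteq\xi\subseteq\hat\nu$; one always exists. Write $x\succ y$ for $xy\in\xi$, $x\succeq y$ for $x\succ y$ or $x=y$, and $x'$ for the immediate successor of $x$ in $\xi$ (for $x$ not last). Given an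 admissible order $\xi$, the projected scores are obtained as follows. (i) For $x\succ y$: $m^\sigma_{xy}=\min\{m^\nu_{pq}: p\succeq x,\ y\succeq q\}$. (ii) $(t^\sigma_{xy})_{xy\in\Pi}$ is the unique minimizer of $\sum_{xy\in\Pi}(\tau_{xy}-t_{xy})^2$ among all real families $(\tau_{xy})_{xy\in\Pi}$ such that $\tau_{xy}=\tau_{yx}$ for all $xy$; $m^\sigma_{xx'}\le\tau_{xx'}\le1$ for all non-last $x$; $0\le\tau_{xy}-\tau_{xy'}\le m^\sigma_{yy'}$ for all non-last $y$ and all $x\notin\{y,y'\}$. (iii) $\gamma_{xx'}=[(t^\sigma_{xx'}-m^\sigma_{xx'})/2,\ (t^\sigma_{xx'}+m^\sigma_{xx'})/2]$, and for $x\succ y$, $\gamma_{xy}=\bigcup\{\gamma_{pp'}: x\succeq p\succ y\}$, which is a closed interval. (iv) For $x\succ y$: $v^\pi_{xy}=\max\gamma_{xy}$, $v^\pi_{yx}=\min\gamma_{xy}$. The projected scores do not depend on the choice of $\xi$. Put $t^\pi_{xy}=v^\pi_{xy}+v^\pi_{yx}$. Rank-like rates: $r_x=N-\sum_{y\ne x}v^\pi_{xy}$. Fraction-like rates (for a given $f\in(0,1]$ and $v\neq0$, in which case $(v^\pi_{xy})\ne0$): there is a unique nonempty set $X\subseteq A$ (the top dominant irreducible component of $(v^\pi_{xy})$) such that any two distinct elements of $X$ can be joined in both directions by paths along which $v^\pi>0$, every $y\notin X$ can be reached from every $x\in X$ by such a path, and no $x\in X$ can be reached by such a path from any $y\notin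 X$. Then $\varphi_x=0$ for $x\notin X$, and $(\varphi_x)_{x\in X}$ is the unique family of positive numbers with $\sum_{x\in X}\varphi_x=f$ and $\sum_{y\in X,\,y\ne x}t^\pi_{xy}\,\varphi_x/(\varphi_x+\varphi_y)=\sum_{y\in X,\,y\neq x}v^\pi_{xy}$ for all $x\in X$. *)

(* Defs.v *)
From HB Require Import structures.
From mathcomp Require Import all_boot all_order all_algebra.
From mathcomp Require Import all_classical all_reals all_analysis.

Set Implicit Arguments.
Unset Strict Implicit.
Unset Printing Implicit Defensive.

Import Order.TTheory GRing.Theory Num.Theory.
Import numFieldNormedType.Exports.

Local Open Scope classical_set_scope.
Local Open Scope ring_scope.

Definition pairs (A : finType) := {p : A * A | p.1 != p.2}.

(* R^Pi; being finite-dimensional, its product topology is the usual one. *)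
Definition score_family (R : realType) (A : finType) := {ptws pairs A -> R}.

(* [entry w x y] is w_xy; the diagonal value 0 is a filler, since families are
   indexed by pairs of distinct elements only. *)
Definition entry (R : realType) (A : finType) (w : score_family R A) (x y : A) : R :=
  if insub (x, y) is Some p then w p else 0.

Definition mk_scores (R : realType) (A : finType) (F : A -> A -> R) :
  score_family R A := fun p => F (val p).1 (val p).2.

Definition turnover (R : realType) (A : finType) (w : score_family R A) :
  score_family R A := mk_scores (fun x y => entry w x y + entry w y x).

Definition Llull (R : realType) (A : finType) : set (score_family R A) :=
  [set v | forall x y : A, x != y ->
     0 <= entry v x y <= 1 /\ entry v x y + entry v y x <= 1].
Arguments Llull R A : clear implicits.

(* The maximum and minimum of a set of reals (0 when not attained). *)
Definition maximum (R : realType) (S : set R) : R := xget 0 (S `&` ubound S).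
Definition minimum (R : realType) (S : set R) : R := xget 0 (S `&` lbound S).

(* The path x, a, s_0, s_1, ... is given by its first vertex x, its second
   vertex a and the list s of the remaining ones, so it has at least one link. *)
Fixpoint path_min (R : realType) (A : finType) (v : score_family R A)
    (x a : A) (s : seq A) : R :=
  if s is b :: s' then Num.min (entry v x a) (path_min v a b s')
  else entry v x a.

Definition indirect (R : realType) (A : finType) (v : score_family R A)
    (x y : A) : R :=
  maximum [set r | exists a s,
    [/\ path (fun b c : A => b != c) x (a :: s), last a s = y
      & r = path_min v x a s]].

Definition margin_nu (R : realType) (A : finType) (v : score_family R A)
    (x y : A) : R :=
  indirect v x y - indirect v y x.

Definition nu (R : realType) (A : finType) (v : score_family R A) : rel A :=
  fun x y => (x != y) && (0 < margin_nu v x y).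

Definition nu_hat (R : realType) (A : finType) (v : score_family R A) : rel A :=
  fun x y => (x != y) && (0 <= margin_nu v x y).

Definition strict_total_order (A : finType) (xi : rel A) : Prop :=
  [/\ irreflexive xi, transitive xi
    & forall x y, x != y -> xi x y || xi y x].

Definition admissible (R : realType) (A : finType) (v : score_family R A)
    (xi : rel A) : Prop :=
  [/\ strict_total_order xi, subrel (nu v) xi & subrel xi (nu_hat v)].

Definition weak (A : finType) (xi : rel A) : rel A :=
  fun x y => (x == y) || xi x y.

(* [next_in xi x x']: x' is the immediate successor of x in xi; there is none
   when x is last. *)
Definition next_in (A : finType) (xi : rel A) : rel A :=
  fun x x' => xi x x' && [forall z, ~~ (xi x z && xi z x')].

(* Only meaningful for x, y with [xi x y]. *)
Definition margin_sigma (R : realType) (A : finType) (v : score_family R A)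
    (xi : rel A) (x y : A) : R :=
  minimum [set m | exists p q,
    [/\ weak xi p x, weak xi y q & m = margin_nu v p q]].

Definition feasible (R : realType) (A : finType) (v : score_family R A)
    (xi : rel A) : set (score_family R A) :=
  [set tau |
    [/\ forall x y, x != y -> entry tau x y = entry tau y x,
        forall x x', next_in xi x x' ->
          margin_sigma v xi x x' <= entry tau x x' <= 1
      & forall y y', next_in xi y y' -> forall x, x != y -> x != y' ->
          0 <= entry tau x y - entry tau x y' <= margin_sigma v xi y y']].

Definition sqdist (R : realType) (A : finType) (w w' : score_family R A) : R :=
  \sum_(p : pairs A) (w p - w' p) ^+ 2.

Definition turnover_sigma (R : realType) (A : finType) (v : score_family R A)
    (xi : rel A) : score_family R A :=
  xget (fun=> 0) [set tau | feasible v xi tau /\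
    forall tau', feasible v xi tau' ->
      sqdist tau (turnover v) <= sqdist tau' (turnover v)].

Definition gamma_next (R : realType) (A : finType) (v : score_family R A)
    (xi : rel A) (x x' : A) : set R :=
  let t := entry (turnover_sigma v xi) x x' in
  let m := margin_sigma v xi x x' in
  `[(t - m) / 2, (t + m) / 2].

Definition gamma (R : realType) (A : finType) (v : score_family R A)
    (xi : rel A) (x y : A) : set R :=
  [set z | exists p p',
    [/\ weak xi x p, xi p y, next_in xi p p' & gamma_next v xi p p' z]].

Definition projected_along (R : realType) (A : finType) (v : score_family R A)
    (xi : rel A) : score_family R A :=
  mk_scores (fun x y =>
    if xi x y then maximum (gamma v xi x y) else minimum (gamma v xi y x)).

(* All admissible orders yield the same family, so this set is a singleton. *)
Definition projected_scores (R : realType) (A : finType) (v : score_family R A) :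
    score_family R A :=
  xget (fun=> 0) [set w | exists2 xi : rel A,
    admissible v xi & w = projected_along v xi].

Definition rank_rate (R : realType) (A : finType) (v : score_family R A) (x : A) : R :=
  #|A|%:R - \sum_(y | y != x) entry (projected_scores v) x y.

(* [connect] is reflexive, which is harmless: it is only applied below to
   distinct elements. The diagonal filler 0 of [entry] creates no loop. *)
Definition joined (R : realType) (A : finType) (w : score_family R A) : rel A :=
  connect (fun x y => 0 < entry w x y).

Definition top_dominant (R : realType) (A : finType) (w : score_family R A)
    (X : {set A}) : Prop :=
  [/\ X != finset.set0,
      forall x y, x \in X -> y \in X -> x != y -> joined w x y,
      forall x y, x \in X -> y \notin X -> joined w x y
    & forall x y, x \in X -> y \notin X -> ~~ joined w y x].

Definition top_component (R : realType) (A : finType) (w : score_family R A) :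
    {set A} :=
  xget finset.set0 [set X | top_dominant w X].

Definition fraction_system (R : realType) (A : finType) (w : score_family R A)
    (f : R) (phi : A -> R) : Prop :=
  let X := top_component w in
  [/\ forall x, x \notin X -> phi x = 0,
      forall x, x \in X -> 0 < phi x,
      \sum_(x in X) phi x = f
    & forall x, x \in X ->
        \sum_(y in X | y != x)
           entry (turnover w) x y * (phi x / (phi x + phi y))
        = \sum_(y in X | y != x) entry w x y].

Definition fraction_rate (R : realType) (A : finType) (f : R)
    (v : score_family R A) : A -> R :=
  xget (fun=> 0) [set phi | fraction_system (projected_scores v) f phi].

(* Main.v *)
(* Continuity is tested along ultrafilters G --> v0: bounded quantities converge
   along G, and a choice among finitely many possibilities is eventually constant,
   so one admissible order xi serves for all v near v0 and for v0 itself.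
   For a fixed xi the turnovers converge, since a limit of minimizers minimizes:
   every family feasible at v0 becomes feasible at nearby v when it is moved
   slightly towards the constant 1. The projection does not depend on xi, because
   exchanging two adjacent elements with zero margin does not change it.
   For the fraction-like rates, a limit l of solutions of the systems at v is
   supported exactly by the top component at v0; there l solves the limit system,
   whose positive solution is unique. *)

(* Two obstacles shape the argument. First, the feasible set moves with [v], and a family feasible
   at [v0] may violate the constraints at nearby [v]. The constant 1 is feasible for every [v],
   because the margins lie in [0, 1]; a mixture with it leaves slack in the constraints, except in
   bounds where the margin is 0 or 1, and those bounds are safe since no margin leaves [0, 1].
   Second, the top component at nearby [v] can be strictly larger than at [v0], and the share a / (a
   + b) is discontinuous at (0, 0). Hence the equations of elements whose rate tends to 0 have no
   usable limit. Only equations of elements in the support of the limit are passed to the limit, one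
   by one or summed over a subset of the support, where the internal terms cancel. The hypothesis v
   <> 0 makes the first element of an admissible order score positively against all others, which
   yields a top component. *)
Require Import Defs.
From mathcomp Require Import all_boot all_order all_algebra.
From mathcomp Require Import ring lra.
From mathcomp Require Import all_classical all_reals all_analysis.
Set Implicit Arguments.
Unset Strict Implicit.
Unset Printing Implicit Defensive.

Import Order.TTheory GRing.Theory Num.Theory.
Import numFieldNormedType.Exports.
Local Open Scope classical_set_scope.
Local Open Scope ring_scope.

(** * Limits along ultrafilters *)

Section FilterLimits.
Variables (R : realType) (T : Type) (G : set_system T).
Context {GF : ProperFilter G}.

Lemma near_ex2 (P Q : T -> Prop) :
  (\forall x \near G, P x) -> (\forall x \near G, Q x) -> exists x, P x /\ Q x.
Proof.
by move=> nP nQ; have /filter_ex [x []] : G (P `&` Q) by [exact: filterI]; exists x.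
Qed.

Lemma cvg_le_lim (f g : T -> R) (a b : R) :
  f x @[x --> G] --> a -> g x @[x --> G] --> b ->
  (\forall x \near G, f x <= g x) -> a <= b.
Proof.
move=> fa gb fg; rewrite -subr_ge0.
have h : g x - f x @[x --> G] --> b - a by exact: cvgB.
have fg' : \forall x \near G, 0 <= g x - f x.
  by apply: filterS fg => x; rewrite subr_ge0.
exact: (@closed_cvg _ _ _ _ (fun x => g x - f x) _ (@closed_ge R 0) fg' _ h).
Qed.

Lemma cvg_eq_lim (f g : T -> R) (a b : R) :
  f x @[x --> G] --> a -> g x @[x --> G] --> b ->
  (\forall x \near G, f x = g x) -> a = b.
Proof.
move=> fa gb fg; apply/eqP; rewrite eq_le; apply/andP; split.
  by apply: cvg_le_lim fa gb _; apply: filterS fg => x ->.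
by apply: cvg_le_lim gb fa _; apply: filterS fg => x ->.
Qed.

Lemma cvg_bigsum (I : finType) (P : pred I) (f : I -> T -> R) (l : I -> R) :
  (forall i, P i -> f i x @[x --> G] --> l i) ->
  \sum_(i | P i) f i x @[x --> G] --> \sum_(i | P i) l i.
Proof. by move=> fl; apply: cvg_big => //; exact: add_continuous. Qed.

Lemma cvg_lt_near (f g : T -> R) (a b : R) :
  f x @[x --> G] --> a -> g x @[x --> G] --> b -> a < b ->
  \forall x \near G, f x < g x.
Proof.
move=> fa gb ab.
have h : g x - f x @[x --> G] --> b - a by exact: cvgB.
have ab0 : 0 < b - a by rewrite subr_gt0.
have gf : \forall x \near G, 0 < g x - f x by exact: (cvgr_gt _ h).
by apply: filterS gf => x; rewrite subr_gt0.
Qed.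

Lemma cvg_near_eq (f g : T -> R) (a : R) :
  (\forall x \near G, f x = g x) -> g x @[x --> G] --> a ->
  f x @[x --> G] --> a.
Proof.
move=> fg ga; apply: cvg_trans ga; apply: near_eq_cvg.
by apply: filterS fg => x ->.
Qed.

End FilterLimits.

Section Ultrafilters.
Variable R : realType.

(* An ultrafilter plays the part of a convergent sequence for which every
   subsequence extraction has already been done. *)
Lemma within_continuous_ultra (T : topologicalType) (D : set T) (f : T -> R) :
  (forall (G : set_system T) (x : T), UltraFilter G -> G D -> D x ->
     G --> x -> f y @[y --> G] --> f x) ->
  {within D, continuous f}.
Proof.
move=> H; apply/subspace_continuousP => x Dx B Bx.
apply: contrapT => nB.
have FP : ProperFilter (within (D `&` ~` (f @^-1` B)) (nbhs x)).
  apply: Build_ProperFilter_ex.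
  move=> P; rewrite /within/= => nP.
  apply: contrapT => nex; apply: nB.
  rewrite /fmap/= /within/=; apply: filterS nP => y Py Dy.
  apply: contrapT => nBy; apply: nex; exists y; exact: Py.
have [G [GU sG]] := ultraFilterLemma FP.
have GD : G (D `&` ~` (f @^-1` B)).
  by apply: sG; rewrite /within/=; apply: filterS filterT.
have GB : G (f @^-1` B).
  apply: (H G x) => //; first by apply: filterS GD => y [].
  by move=> V Vx; apply: sG; rewrite /within/=; apply: filterS Vx.
by have [y [[_ ny] By]] := near_ex2 GD GB.
Qed.

Variables (T : Type) (G : set_system T).
Context {GU : UltraFilter G}.

(** Compactness of [a, b] gives a cluster point. An ultrafilter converges to it: it contains the
    preimage of each neighbourhood or its complement, and the latter contradicts clustering. *)
Lemma ultra_bounded_cvg (f : T -> R) (a b : R) :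
  (\forall x \near G, a <= f x <= b) ->
  exists2 l, a <= l <= b & f x @[x --> G] --> l.
Proof.
move=> fab.
have FP : ProperFilter (f @ G) by exact: fmap_proper_filter.
have [|l [/= lab cl]] := @segment_compact R a b (f @ G) FP.
  by apply: filterS fab => x /= xab; rewrite /= in_itv.
exists l; first by move: lab; rewrite in_itv.
move=> B Bl; have [//|nB] := in_ultra_setVsetC (f @^-1` B) GU.
have [|y [ny By]] := cl (~` B) B _ Bl; first exact: nB.
by case: ny.
Qed.

(** If no single [k] worked, all the complements would be in [G], hence also their finite
    intersection, which misses the union. *)
Lemma ultra_finite_choice (K : finType) (P : K -> T -> Prop) :
  (\forall x \near G, exists k, P k x) -> exists k, \forall x \near G, P k x.
Proof.
move=> nP; apply: contrapT => nex.
have all k : G (~` [set x | P k x]).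
  by have [Pk|//] := in_ultra_setVsetC [set x | P k x] GU; case: nex; exists k.
have nP' : G (fun x => forall k, ~ P k x) by apply: filter_forall; exact: all.
by have [x [[k Pkx] /(_ k)]] := near_ex2 nP nP'.
Qed.

End Ultrafilters.

(** The second hypothesis stands in for compactness of [D] and continuity of [J], with no topology
    on [T]. The sublevel sets are nested, so they generate a filter; the limit provided for an
    ultrafilter refining it lies below every value of [J]. It serves both for the least-squares
    problem and for the likelihood. *)
Lemma ultra_argmin (R : realType) (T : Type) (D : set T) (J : T -> R) :
  D !=set0 ->
  (forall G : set_system T, UltraFilter G -> G D ->
     exists2 l, D l & J x @[x --> G] --> J l) ->
  exists2 l, D l & forall x, D x -> J l <= J x.
Proof.
move=> [x0 Dx0] H.
pose B x : set T := [set y | D y /\ J y <= J x].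
have FF : Filter (filter_from D B).
  apply: filter_from_filter; first by exists x0.
  move=> x y Dx Dy; have [le_xy|lt_yx] := leP (J x) (J y).
    by exists x => // z [Dz Jz]; split; split => //; exact: le_trans le_xy.
  by exists y => // z [Dz Jz]; split; split => //; exact: le_trans (ltW lt_yx).
have PF : ProperFilter (filter_from D B).
  by apply: filter_from_proper => x Dx; exists x; split.
have [G [GU sG]] := ultraFilterLemma PF.
have GB x : D x -> G (B x) by move=> Dx; apply: sG; exists x.
have GD : G D by apply: filterS (GB _ Dx0) => y [].
have [l Dl Jl] := H G GU GD; exists l => // x Dx.
apply: cvg_le_lim Jl (cvg_cst (J x)) _.
by apply: filterS (GB _ Dx) => y [].
Qed.

(** * Indirect scores and admissible orders *)

Section Entries.
Variables (R : realType) (A : finType).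
Implicit Types (w : score_family R A) (x y : A).

Lemma entry_mk (F : A -> A -> R) x y :
  x != y -> entry (mk_scores F) x y = F x y.
Proof. by move=> xy; rewrite /entry insubT. Qed.

Lemma entryxx w x : entry w x x = 0.
Proof. by rewrite /entry insubF //= eqxx. Qed.

Lemma entry_val w (p : pairs A) : w p = entry w (val p).1 (val p).2.
Proof. by rewrite /entry -surjective_pairing valK. Qed.

Lemma entry_inj w w' :
  (forall x y, x != y -> entry w x y = entry w' x y) -> w = w'.
Proof. by move=> ww'; apply/funext => p; rewrite !entry_val ww' // (valP p). Qed.

Lemma cvg_entry (G : set_system (score_family R A)) w x y :
  Filter G -> G --> w -> entry v x y @[v --> G] --> entry w x y.
Proof.
move=> GF Gw; rewrite /entry; case: insubP => [p _ _|_]; last exact: cvg_cst.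
apply: (@cvg_comp _ _ _ id (fun v : score_family R A => v p) G (nbhs w)) => //.
exact: (@proj_continuous (pairs A) (fun=> R) p w).
Qed.

End Entries.

Section Extrema.
Variable R : realType.

Lemma maximumE (S : set R) m : S m -> ubound S m -> maximum S = m.
Proof.
move=> Sm um; apply: xget_unique => // y [Sy uy].
by apply/eqP; rewrite eq_le um //= uy.
Qed.

Lemma minimumE (S : set R) m : S m -> lbound S m -> minimum S = m.
Proof.
move=> Sm lm; apply: xget_unique => // y [Sy ly].
by apply/eqP; rewrite eq_le ly //= lm.
Qed.

Lemma finite_argmax (I : finType) (P : I -> Prop) (F : I -> R) :
  (exists i, P i) -> exists2 i, P i & forall j, P j -> F j <= F i.
Proof.
case=> i0 Pi0.
have Q0 : [pred i | `[< P i >]] i0 by apply/asboolP.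
case: (arg_maxP F Q0) => i /asboolP Pi H.
by exists i => // j Pj; apply: H; apply/asboolP.
Qed.

Lemma finite_argmin (I : finType) (P : I -> Prop) (F : I -> R) :
  (exists i, P i) -> exists2 i, P i & forall j, P j -> F i <= F j.
Proof.
move=> /(@finite_argmax I P (fun i => - F i)) [i Pi H].
by exists i => // j /H; rewrite lerN2.
Qed.

Variables (T : Type) (G : set_system T).
Context {GU : UltraFilter G}.

(** Along an ultrafilter one fixed index [i] attains the minimum, so [m] tends to [l i]. Comparison
    with the index attaining the minimum at the limit gives [l i <= m0]. *)
Lemma cvg_finite_min (I : finType) (P : I -> Prop) (F : I -> T -> R) (l : I -> R)
    (m : T -> R) (m0 : R) :
  (forall i, P i -> F i x @[x --> G] --> l i) ->
  (\forall x \near G, exists2 i, P i & m x = F i x) ->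
  (\forall x \near G, forall i, P i -> m x <= F i x) ->
  (exists2 i, P i & m0 = l i) ->
  (forall i, P i -> m0 <= l i) ->
  m x @[x --> G] --> m0.
Proof.
move=> Fl mF mle [i0 Pi0 m0E] m0le.
have mF' : \forall x \near G, exists i, P i /\ m x = F i x.
  by apply: filterS mF => x [i Pi mi]; exists i.
have [i ni] := @ultra_finite_choice _ _ GU _ (fun i x => P i /\ m x = F i x) mF'.
have /filter_ex [_ [Pi _]] := ni.
suff -> : m0 = l i.
  by apply: cvg_near_eq (Fl _ Pi); apply: filterS ni => x [].
apply/eqP; rewrite eq_le m0le //= m0E.
apply: cvg_le_lim (Fl _ Pi) (Fl _ Pi0) _.
by apply: filterS2 ni mle => x [_ <-]; apply.
Qed.

Lemma cvg_finite_max (I : finType) (P : I -> Prop) (F : I -> T -> R) (l : I -> R)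
    (m : T -> R) (m0 : R) :
  (forall i, P i -> F i x @[x --> G] --> l i) ->
  (\forall x \near G, exists2 i, P i & m x = F i x) ->
  (\forall x \near G, forall i, P i -> F i x <= m x) ->
  (exists2 i, P i & m0 = l i) ->
  (forall i, P i -> l i <= m0) ->
  m x @[x --> G] --> m0.
Proof.
move=> Fl mF mle [i0 Pi0 m0E] m0le.
have -> : m = (fun x => - - m x) by apply/funext => x; rewrite opprK.
rewrite -[m0]opprK; apply: cvgN.
apply: (@cvg_finite_min I P (fun i x => - F i x) (fun i => - l i)).
- by move=> i Pi; apply: cvgN; exact: Fl.
- by apply: filterS mF => x [i Pi ->]; exists i.
- by apply: filterS mle => x h i Pi; rewrite lerN2 h.
- by exists i0 => //; rewrite m0E.
- by move=> i Pi; rewrite lerN2 m0le.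
Qed.

End Extrema.

Section Indirect.
Variables (R : realType) (A : finType).
Implicit Types (v : score_family R A) (x y z : A).

Local Notation links x a s := (path (fun b c : A => b != c) x (a :: s)).

(** There are infinitely many paths, but their minima are entries, hence finitely many values. This
    is why the maximum defining the indirect score is attained. *)
Lemma path_min_entry v x a s : links x a s ->
  exists b c, b != c /\ path_min v x a s = entry v b c.
Proof.
elim: s x a => [|b s IH] x a /=; first by rewrite /= andbT; exists x, a.
move=> /and3P [xa ab sP].
have [|c [d [cd E]]] := IH a b; first by rewrite /= ab.
by rewrite minEle; case: ifP => _; [exists x, a | exists c, d].
Qed.

Lemma path_min_cat v x a s b s' :
  path_min v x a (s ++ b :: s')
  = Num.min (path_min v x a s) (path_min v (last a s) b s').
Proof. by elim: s x a => [|c s IH] x a //=; rewrite IH minA. Qed.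

Lemma indirectP v x y : x != y ->
  (exists a s, [/\ links x a s, last a s = y & indirect v x y = path_min v x a s])
  /\ forall a s, links x a s -> last a s = y -> path_min v x a s <= indirect v x y.
Proof.
move=> xy.
pose S : set R := [set r | exists a s,
    [/\ path (fun b c : A => b != c) x (a :: s), last a s = y
      & r = path_min v x a s]].
have Sxy : S (entry v x y) by exists y, [::]; rewrite /= xy.
have [|[b c] /= Sbc mbc] := @finite_argmax R _ (fun p : A * A => S (entry v p.1 p.2))
  (fun p => entry v p.1 p.2); first by exists (x, y).
have E : indirect v x y = entry v b c.
  apply: maximumE => // r [a [s [sP sl ->]]].
  have [d [e [_ E]]] := path_min_entry v sP; rewrite E.
  by apply: (mbc (d, e)); rewrite /= -E; exists a, s.
split; first by case: Sbc => a [s [? ? ?]]; exists a, s; rewrite E.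
move=> a s sP sl; rewrite E.
have [d [e [_ E']]] := path_min_entry v sP; rewrite E'.
by apply: (mbc (d, e)); rewrite /= -E'; exists a, s.
Qed.

Lemma indirect_bounds v x y : Llull R A v -> x != y -> 0 <= indirect v x y <= 1.
Proof.
move=> vL xy; have [[a [s [sP _ ->]]] _] := indirectP v xy.
by have [b [c [bc ->]]] := path_min_entry v sP; have [] := vL _ _ bc.
Qed.

Lemma margin_le1 v x y : Llull R A v -> x != y -> margin_nu v x y <= 1.
Proof.
move=> vL xy; rewrite /margin_nu.
have /andP [_] := indirect_bounds vL xy.
rewrite eq_sym in xy; have /andP [] := indirect_bounds vL xy; lra.
Qed.

Lemma margin_nuN v x y : margin_nu v x y = - margin_nu v y x.
Proof. by rewrite /margin_nu opprB. Qed.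

Lemma indirect_triangle v x y z : x != y -> y != z -> x != z ->
  Num.min (indirect v x y) (indirect v y z) <= indirect v x z.
Proof.
move=> xy yz xz.
have [[a [s [sP sl ->]]] _] := indirectP v xy.
have [[b [t [tP tl ->]]] _] := indirectP v yz.
have [_ /(_ a (s ++ b :: t))] := indirectP v xz.
rewrite path_min_cat sl; apply; last by rewrite last_cat.
move: sP tP; rewrite /= cat_path sl => /andP [-> ->] /=.
by move=> /andP [-> ->].
Qed.

(** Suppose v*_xz <= v*_zx. If v*_xy <= v*_yz, then v*_zx >= v*_xz >= v*_xy, so v*_yx >= min(v*_yz,
    v*_zx) >= v*_xy, against m_xy > 0. The case v*_yz <= v*_xy contradicts m_yz > 0 in the same way
    through v*_zy. *)
Lemma nu_trans v : transitive (nu v).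
Proof.
move=> y x z /andP [xy mxy] /andP [yz myz].
have xz : x != z.
  apply/eqP => xz; move: myz mxy; rewrite -xz (margin_nuN v y x); lra.
rewrite /nu xz /=; rewrite /margin_nu in mxy myz *.
have h1 := indirect_triangle v xy yz xz.
have zy : z != y by rewrite eq_sym.
have zx : z != x by rewrite eq_sym.
have yx : y != x by rewrite eq_sym.
have h2 := indirect_triangle v yz zx yx.
have h3 := indirect_triangle v zx xy zy.
move: h1 h2 h3; rewrite !minEle.
by case: ifP => h1; case: ifP => h2; case: ifP => h3; lra.
Qed.

Lemma nu_irr v : irreflexive (nu v).
Proof. by move=> x; rewrite /nu eqxx. Qed.

Lemma strict_order_asym (xi : rel A) : strict_total_order xi ->
  forall x y, xi x y -> xi y x = false.
Proof.
move=> [irr tr _] x y xy; apply/negP => yx.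
by have := irr x; rewrite (tr _ _ _ xy yx).
Qed.

(** The upper inclusion comes for free: if [xi x y] held with m_yx > 0, then [nu v y x] would force
    [xi y x], against asymmetry. *)
Lemma admissibleP v (xi : rel A) :
  strict_total_order xi -> subrel (nu v) xi -> admissible v xi.
Proof.
move=> xiT nuxi; split => // x y xy; have yx := strict_order_asym xiT xy.
have nxy : x != y.
  by apply/eqP => E; have [irr _ _] := xiT; move: xy; rewrite E irr.
rewrite /nu_hat nxy /= margin_nuN oppr_ge0 leNgt.
apply/negP => myx; suff : xi y x by rewrite yx.
by apply: nuxi; rewrite /nu eq_sym nxy.
Qed.

(* The number of nu-predecessors is strictly increasing along nu, since nu is
   transitive; enum_rank breaks the ties. *)
Lemma admissible_exists v : exists xi, admissible v xi.
Proof.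
pose h x := #|[pred z | nu v z x]|.
pose xi : rel A :=
  fun x y => (h x < h y)%N || ((h x == h y) && (enum_rank x < enum_rank y)%N).
exists xi; apply: admissibleP; last first.
  move=> x y xy; rewrite /xi; suff -> : (h x < h y)%N by [].
  apply: proper_card; apply/properP; split.
    by apply/fintype.subsetP => z; rewrite !inE => zx; apply: nu_trans zx xy.
  by exists x; rewrite !inE ?nu_irr.
split.
- by move=> x; rewrite /xi !ltnn andbF.
- move=> y x z; rewrite /xi => /orP [xy|/andP [/eqP xy rxy]].
    move=> /orP [yz|/andP [/eqP <- _]]; last by rewrite xy.
    by rewrite (ltn_trans xy yz).
  move=> /orP [yz|/andP [/eqP yz ryz]]; first by rewrite xy yz.
  by rewrite xy yz eqxx (ltn_trans rxy ryz) orbT.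
- move=> x y xy; rewrite /xi; case: (ltngtP (h x) (h y)) => //= _.
  case: (ltngtP (enum_rank x) (enum_rank y)) => // /val_inj/enum_rank_inj E.
  by rewrite E eqxx in xy.
Qed.

Lemma path_min_close v v' e x a s : (forall b c, entry v b c <= entry v' b c + e) ->
  path_min v x a s <= path_min v' x a s + e.
Proof.
move=> H; elim: s x a => [|b s IH] x a /=; first exact: H.
have := IH a b; have := H x a; rewrite !minEle.
by case: ifP => h1; case: ifP => h2; lra.
Qed.

(** Used in both directions, this makes the indirect scores 1-Lipschitz for the sup distance. *)
Lemma indirect_close v v' e x y : x != y ->
  (forall b c, entry v b c <= entry v' b c + e) ->
  indirect v x y <= indirect v' x y + e.
Proof.
move=> xy H; have [[a [s [sP sl ->]]] _] := indirectP v xy.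
have [_ /(_ _ _ sP sl)] := indirectP v' xy.
have := path_min_close x a s H; lra.
Qed.

Variables (G : set_system (score_family R A)) (v0 : score_family R A).
Context {GF : ProperFilter G}.
Hypothesis Gv0 : G --> v0.

Lemma cvg_indirect x y : x != y -> indirect v x y @[v --> G] --> indirect v0 x y.
Proof.
move=> xy; apply/cvgrPdist_le => e e0.
have H : \forall v \near G, forall p : A * A,
    `|entry v0 p.1 p.2 - entry v p.1 p.2| <= e.
  apply: filter_forall => -[b c] /=.
  have /cvgrPdist_le : entry v b c @[v --> G] --> entry v0 b c by exact: cvg_entry.
  exact.
apply: filterS H => v H; rewrite ler_distl.
have h1 : indirect v0 x y <= indirect v x y + e.
  by apply: indirect_close => // b c; have := H (b, c); rewrite ler_distl /=; lra.
have h2 : indirect v x y <= indirect v0 x y + e.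
  by apply: indirect_close => // b c; have := H (b, c); rewrite ler_distl /=; lra.
by rewrite lerBlDr h1 h2.
Qed.

Lemma cvg_margin x y : x != y -> margin_nu v x y @[v --> G] --> margin_nu v0 x y.
Proof. by move=> xy; apply: cvgB; apply: cvg_indirect => //; rewrite eq_sym. Qed.

(** A margin that is positive at [v0] stays positive nearby, so the relation [nu v0] is contained in
    [xi]; the other inclusion follows by [admissibleP]. *)
Lemma admissible_lim xi :
  (\forall v \near G, admissible v xi) -> admissible v0 xi.
Proof.
move=> adm; have /filter_ex [v [xiT _ _]] := adm.
apply: admissibleP => // x y /andP [xy mxy].
have pos : \forall v \near G, 0 < margin_nu v x y.
  exact: cvg_lt_near (cvg_cst (0 : R)) (cvg_margin xy) mxy.
have [u [um [_ nuxi _]]] := near_ex2 pos adm.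
by apply: nuxi; rewrite /nu xy.
Qed.

End Indirect.
(** * Feasible turnovers and their least-squares projection *)

Section Orders.
Variables (A : finType) (xi : rel A).
Hypothesis xiT : strict_total_order xi.

(** It is strictly increasing along [xi]: its extrema locate immediate neighbours, and it is the
    measure for inductions along the order. *)
Definition height (x : A) : nat := #|[pred z | xi z x]|.

Lemma order_irr x : xi x x = false.
Proof. by have [irr _ _] := xiT. Qed.

Lemma order_trans x y z : xi x y -> xi y z -> xi x z.
Proof. by have [_ tr _] := xiT; apply: tr. Qed.

Lemma order_neq x y : xi x y -> x != y.
Proof. by move=> xy; apply/eqP => E; rewrite E order_irr in xy. Qed.

Lemma weak_order_trans x y z : weak xi x y -> xi y z -> xi x z.
Proof. by case/orP => [/eqP ->//|]; apply: order_trans. Qed.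

Lemma order_weak_trans x y z : xi x y -> weak xi y z -> xi x z.
Proof. by move=> xy /orP [/eqP <-//|]; apply: order_trans. Qed.

Lemma weak_trans x y z : weak xi x y -> weak xi y z -> weak xi x z.
Proof.
by case/orP => [/eqP ->//|xy] yz; rewrite /weak (order_weak_trans xy yz) orbT.
Qed.

Lemma weak_refl x : weak xi x x.
Proof. by rewrite /weak eqxx. Qed.

Lemma orderW x y : xi x y -> weak xi x y.
Proof. by rewrite /weak => ->; rewrite orbT. Qed.

Lemma weak_total x y : ~~ xi x y = weak xi y x.
Proof.
have [_ _ tot] := xiT; rewrite /weak.
have [->|yx] := eqVneq y x; first by rewrite order_irr.
case xy: (xi x y); first by rewrite (strict_order_asym xiT xy).
by have := tot _ _ yx; rewrite xy orbF => ->.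
Qed.

Lemma height_lt x y : xi x y -> (height x < height y)%N.
Proof.
move=> xy; apply: proper_card; apply/properP; split.
  by apply/fintype.subsetP => z; rewrite !inE => zx; apply: order_trans zx xy.
by exists x; rewrite !inE ?order_irr.
Qed.

Lemma next_inW x y : next_in xi x y -> xi x y.
Proof. by case/andP. Qed.

Lemma next_ex x y : xi x y -> exists2 z, next_in xi x z & weak xi z y.
Proof.
move=> xy; have P0 : [pred z | xi x z && weak xi z y] y by rewrite /= xy weak_refl.
case: (arg_minnP height P0) => z /andP [xz zy] H; exists z => //.
rewrite /next_in xz; apply/forallP => u; apply/negP => /andP [xu uz].
have := H u; rewrite /= xu (weak_trans (orderW uz) zy) => /(_ isT).
by rewrite leqNgt height_lt.
Qed.

Lemma prev_ex x y : xi x y -> exists2 z, next_in xi z y & weak xi x z.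
Proof.
move=> xy; have P0 : [pred z | weak xi x z && xi z y] x by rewrite /= xy weak_refl.
have Hb z : [pred z | weak xi x z && xi z y] z -> (height z <= height y)%N.
  by move=> /andP [_ zy]; apply/ltnW/height_lt.
case: (arg_maxnP height P0) => z /andP [xz zy] H; exists z => //.
rewrite /next_in zy; apply/forallP => u; apply/negP => /andP [zu uy].
have := H u; rewrite /= uy (weak_trans xz (orderW zu)) => /(_ isT).
by rewrite /= leqNgt height_lt.
Qed.

Lemma next_in_weak x x' y : next_in xi x x' -> xi x y -> weak xi x' y.
Proof.
move=> /andP [_ /forallP /(_ y)] h xy; rewrite -weak_total.
by move: h; rewrite xy.
Qed.

Lemma prev_in_weak x x' y : next_in xi x x' -> xi y x' -> weak xi y x.
Proof.
move=> /andP [_ /forallP /(_ y)] h yx'; rewrite -weak_total.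
by move: h; rewrite yx' andbT.
Qed.

Lemma weak_anti x y : weak xi x y -> weak xi y x -> x = y.
Proof.
move=> /orP [/eqP //|xy] /orP [/eqP //|].
by rewrite (strict_order_asym xiT xy).
Qed.

Lemma next_in_uniq x y z : next_in xi x y -> next_in xi x z -> y = z.
Proof.
move=> xy xz; apply: weak_anti.
  exact: next_in_weak xy (next_inW xz).
exact: next_in_weak xz (next_inW xy).
Qed.

Lemma prev_in_uniq x y z : next_in xi y x -> next_in xi z x -> y = z.
Proof.
move=> yx zx; apply: weak_anti.
  exact: prev_in_weak zx (next_inW yx).
exact: prev_in_weak yx (next_inW zx).
Qed.

End Orders.

Section MarginSigma.
Variables (R : realType) (A : finType) (xi : rel A).
Implicit Types (v : score_family R A) (x y : A).

Lemma margin_sigmaP v x y :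
  (exists p q, [/\ weak xi p x, weak xi y q
    & margin_sigma v xi x y = margin_nu v p q]) /\
  forall p q, weak xi p x -> weak xi y q -> margin_sigma v xi x y <= margin_nu v p q.
Proof.
have [|[p q] /= [px yq] H] := @finite_argmin R _
  (fun p : A * A => weak xi p.1 x /\ weak xi y p.2) (fun p => margin_nu v p.1 p.2).
  by exists (x, y); rewrite /= !weak_refl.
have E : margin_sigma v xi x y = margin_nu v p q.
  apply: minimumE; first by exists p, q.
  by move=> _ [p' [q' [p'x yq' ->]]]; apply: (H (p', q')).
by split; [exists p, q | move=> p' q' p'x yq'; rewrite E; apply: (H (p', q'))].
Qed.

Lemma margin_sigma_ge0 v x y : admissible v xi -> xi x y -> 0 <= margin_sigma v xi x y.
Proof.
move=> [xiT _ xinu] xy; have [[p [q [px yq ->]]] _] := margin_sigmaP v x y.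
have /xinu/andP [] // : xi p q.
by apply: order_weak_trans yq => //; apply: weak_order_trans xy.
Qed.

Lemma margin_sigma_le1 v x y : Llull R A v -> x != y -> margin_sigma v xi x y <= 1.
Proof.
move=> vL xy; have [_ /(_ x y)] := margin_sigmaP v x y.
rewrite !weak_refl => /(_ isT isT) /le_trans; apply; exact: margin_le1.
Qed.

End MarginSigma.

Section EntryFamilies.
Variables (R : realType) (A : finType).
Implicit Types (w : score_family R A) (x y : A).

Definition convex_comb (l : R) w w' : score_family R A :=
  fun p => (1 - l) * w p + l * w' p.

Lemma entry_conv l w w' x y :
  entry (convex_comb l w w') x y = (1 - l) * entry w x y + l * entry w' x y.
Proof.
by rewrite /entry; case: insub => [p //|]; rewrite !mulr0 addr0.
Qed.

Lemma entry_cst (c : R) x y : x != y -> entry (fun=> c : R) x y = c.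
Proof. by move=> xy; rewrite /entry insubT. Qed.

Variables (T : Type) (G : set_system T).

Lemma cvg_families (f : T -> score_family R A) w : Filter G ->
  (forall x y, entry (f t) x y @[t --> G] --> entry w x y) ->
  forall p, f t p @[t --> G] --> w p.
Proof.
move=> GF fw p; rewrite entry_val; under eq_fun do rewrite entry_val.
exact: fw.
Qed.

Lemma cvg_sqdist (f g : T -> score_family R A) w w' : ProperFilter G ->
  (forall x y, entry (f t) x y @[t --> G] --> entry w x y) ->
  (forall x y, entry (g t) x y @[t --> G] --> entry w' x y) ->
  sqdist (f t) (g t) @[t --> G] --> sqdist w w'.
Proof.
move=> GF fw gw; rewrite /sqdist; apply: cvg_bigsum => p _.
have h : f t p - g t p @[t --> G] --> w p - w' p.
  by apply: cvgB; apply: cvg_families.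
by under eq_fun do rewrite expr2; rewrite expr2; apply: cvgM.
Qed.

Lemma ultra_family_cvg (f : T -> score_family R A) (b : R) : UltraFilter G -> 0 <= b ->
  (\forall t \near G, forall x y, x != y -> 0 <= entry (f t) x y <= b) ->
  exists w, forall x y, entry (f t) x y @[t --> G] --> entry w x y.
Proof.
move=> GU b0 fb.
have H x y : exists l : R, entry (f t) x y @[t --> G] --> l.
  have [->|xy] := eqVneq x y.
    by exists (0 : R); under eq_fun do rewrite entryxx; apply: cvg_cst.
  have [|l _ fl] := @ultra_bounded_cvg R _ G GU (fun t => entry (f t) x y) 0 b.
    by apply: filterS fb => t; apply.
  by exists l.
pose w : score_family R A := mk_scores (fun x y => projT1 (cid (H x y))).
exists w => x y; have [->|xy] := eqVneq x y.
  by rewrite entryxx; under eq_fun do rewrite entryxx; apply: cvg_cst.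
by rewrite entry_mk //; case: (cid (H x y)).
Qed.

End EntryFamilies.

Section Feasible.
Variables (R : realType) (A : finType) (v : score_family R A) (xi : rel A).
Hypotheses (vL : Llull R A v) (adm : admissible v xi).
Let xiT : strict_total_order xi. Proof. by case: adm. Qed.

Lemma feasible_mono_r tau x y z : feasible v xi tau ->
  xi x y -> weak xi y z -> entry tau x z <= entry tau x y.
Proof.
move=> [_ _ taud] xy; have [n] := ubnP (height xi z).
elim: n z => // n IH z; rewrite ltnS => zn /orP [/eqP ->//|yz].
have [u uz yu] := prev_ex xiT yz.
have xu := order_weak_trans xiT xy yu.
have xz := order_trans xiT xy yz.
have := taud _ _ uz x (order_neq xiT xu) (order_neq xiT xz).
have := IH u (leq_trans (height_lt xiT (next_inW uz)) zn) yu; lra.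
Qed.

Lemma feasible_mono_l tau x y z : feasible v xi tau ->
  weak xi x z -> xi z y -> entry tau z y <= entry tau x y.
Proof.
move=> [taus _ taud]; have [n] := ubnP (height xi z).
elim: n z => // n IH z; rewrite ltnS => zn /orP [/eqP ->//|xz] zy.
have [u uz xu] := prev_ex xiT xz.
have uy := order_trans xiT (next_inW uz) zy.
have yz : y != z by rewrite eq_sym (order_neq xiT).
have yu : y != u by rewrite eq_sym (order_neq xiT).
have := taud _ _ uz y yu yz; rewrite taus // (taus _ _ yz).
have := IH u (leq_trans (height_lt xiT (next_inW uz)) zn) xu uy; lra.
Qed.

(** For [xi x y], monotonicity in each argument squeezes the entry between those of two consecutive
    pairs: the one ending at [y] and the one starting at [x]. These are bounded by a nonnegative
    margin and by 1. *)
Lemma feasible_bounds tau x y : feasible v xi tau -> x != y ->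
  0 <= entry tau x y <= 1.
Proof.
move=> tauF; have [taus taun _] := tauF.
wlog xy : x y / xi x y.
  move=> H nxy; have [_ _ /(_ _ _ nxy) /orP [|] h] := xiT; first exact: H.
  by rewrite taus //; apply: H; rewrite 1?eq_sym.
move=> _; apply/andP; split.
  have [z zy xz] := prev_ex xiT xy.
  have := feasible_mono_l tauF xz (next_inW zy).
  have := taun _ _ zy; have := margin_sigma_ge0 adm (next_inW zy); lra.
have [z xz zy] := next_ex xiT xy.
have := feasible_mono_r tauF (next_inW xz) zy; have := taun _ _ xz; lra.
Qed.

Lemma feasible1 : feasible v xi (fun=> 1).
Proof.
split.
- by move=> x y xy; rewrite !entry_cst // eq_sym.
- move=> x x' xx'; have xy := order_neq xiT (next_inW xx').
  by rewrite entry_cst // margin_sigma_le1 //=.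
- move=> y y' yy' x xy xy'; rewrite !entry_cst // subrr lexx /=.
  exact: margin_sigma_ge0 (next_inW yy').
Qed.

Lemma feasible_conv l tau tau' : 0 <= l <= 1 ->
  feasible v xi tau -> feasible v xi tau' -> feasible v xi (convex_comb l tau tau').
Proof.
move=> l01 [s n d] [s' n' d']; split.
- by move=> x y xy; rewrite !entry_conv s // s'.
- by move=> x x' xx'; rewrite !entry_conv; have := n _ _ xx'; have := n' _ _ xx'; nra.
- move=> y y' yy' x xy xy'; rewrite !entry_conv.
  by have := d _ _ yy' x xy xy'; have := d' _ _ yy' x xy xy'; nra.
Qed.

End Feasible.

(** The matrix [u t] is allowed to vary: a constant [u] gives the closedness needed for the
    existence of the projection, [u := id] the feasibility of limits of projections. *)
Lemma feasible_lim (R : realType) (A : finType) (xi : rel A) (T : Type)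
    (G : set_system T) (u f : T -> score_family R A) (v tau : score_family R A) :
  ProperFilter G ->
  (forall x y, xi x y ->
     margin_sigma (u t) xi x y @[t --> G] --> margin_sigma v xi x y) ->
  (\forall t \near G, feasible (u t) xi (f t)) ->
  (forall x y, entry (f t) x y @[t --> G] --> entry tau x y) ->
  feasible v xi tau.
Proof.
move=> GF mcv fF fcv; split.
- move=> x y xy; apply: cvg_eq_lim (fcv x y) (fcv y x) _.
  by apply: filterS fF => t [-> ].
- move=> x x' xx'; apply/andP; split.
    apply: cvg_le_lim (mcv _ _ (next_inW xx')) (fcv x x') _.
    by apply: filterS fF => t [_ /(_ _ _ xx') /andP []].
  apply: cvg_le_lim (fcv x x') (cvg_cst (1 : R)) _.
  by apply: filterS fF => t [_ /(_ _ _ xx') /andP []].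
- move=> y y' yy' x xy xy'.
  have dcv : entry (f t) x y - entry (f t) x y' @[t --> G] -->
    entry tau x y - entry tau x y' by apply: cvgB.
  apply/andP; split.
    apply: cvg_le_lim (cvg_cst (0 : R)) dcv _.
    by apply: filterS fF => t [_ _ /(_ _ _ yy' x xy xy') /andP []].
  apply: cvg_le_lim dcv (mcv _ _ (next_inW yy')) _.
  by apply: filterS fF => t [_ _ /(_ _ _ yy' x xy xy') /andP []].
Qed.

Section SquareDistance.
Variables (R : realType) (A : finType).
Implicit Types (w t : score_family R A).

Lemma sqdist_ge0 w w' : 0 <= sqdist w w'.
Proof. by apply: sumr_ge0 => p _; exact: sqr_ge0. Qed.

Lemma sqdist_eq0 w w' : sqdist w w' <= 0 -> w = w'.
Proof.
move=> h; apply/funext => p; apply/eqP; rewrite -subr_eq0 -sqrf_eq0.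
have h0 : sqdist w w' == 0 by rewrite eq_le h sqdist_ge0.
move: h0; rewrite psumr_eq0; last by move=> q _; exact: sqr_ge0.
by move=> /allP /(_ p); rewrite mem_index_enum => /(_ isT).
Qed.

(** The exact defect of convexity: at l = 1/2 it yields uniqueness of the minimizer, and without the
    last term it is the convexity bound. *)
Lemma sqdist_conv l w w' t : 
  sqdist (convex_comb l w w') t =
  (1 - l) * sqdist w t + l * sqdist w' t - l * (1 - l) * sqdist w w'.
Proof.
rewrite /sqdist !mulr_sumr -big_split -sumrB /=; apply: eq_bigr => p _.
rewrite /convex_comb; ring.
Qed.

Variables (v : score_family R A) (xi : rel A).
Hypotheses (vL : Llull R A v) (adm : admissible v xi).

Lemma turnover_sigma_spec :
  feasible v xi (turnover_sigma v xi) /\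
  forall tau, feasible v xi tau ->
    sqdist (turnover_sigma v xi) (turnover v) <= sqdist tau (turnover v).
Proof.
suff [tau tauF tauM] : exists2 tau, feasible v xi tau & forall tau',
    feasible v xi tau' -> sqdist tau (turnover v) <= sqdist tau' (turnover v).
  rewrite /turnover_sigma; case: xgetP => [_ -> //|] /(_ tau); case; split => //.
apply: ultra_argmin; first by exists (fun=> 1); exact: feasible1.
move=> G GU GF.
have [|tau tcv] := @ultra_family_cvg R A _ G id 1 GU ler01.
  by apply: filterS GF => tau tauF x y; apply: (feasible_bounds adm).
exists tau; last by apply: cvg_sqdist => // x y; exact: cvg_cst.
by apply: (feasible_lim (u := fun=> v)) GF tcv => x y xy; exact: cvg_cst.
Qed.

Lemma turnover_sigmaE tau : feasible v xi tau ->
  (forall tau', feasible v xi tau' ->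
    sqdist tau (turnover v) <= sqdist tau' (turnover v)) ->
  turnover_sigma v xi = tau.
Proof.
move=> tauF tauM; have [sF sM] := turnover_sigma_spec.
apply: sqdist_eq0.
(* If the two minimizers differed, their midpoint would beat them by a quarter of their squared
   distance. *)
have h01 : 0 <= (2^-1 : R) <= 1 by lra.
have := tauM _ (feasible_conv h01 sF tauF); rewrite sqdist_conv.
have := sM _ tauF; lra.
Qed.

End SquareDistance.
(** * Projected scores along a fixed order *)

Section ProjectedAlong.
Variables (R : realType) (A : finType) (v : score_family R A) (xi : rel A).
Hypotheses (vL : Llull R A v) (adm : admissible v xi).
Let xiT : strict_total_order xi. Proof. by case: adm. Qed.

Let t p p' := entry (turnover_sigma v xi) p p'.
Let m p p' := margin_sigma v xi p p'.

Lemma gamma_nextE p p' z :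
  gamma_next v xi p p' z = ((t p p' - m p p') / 2 <= z <= (t p p' + m p p') / 2) :> Prop.
Proof. by rewrite /gamma_next /= in_itv. Qed.

(** The maximum of the union is the greatest right endpoint; that endpoint belongs to its interval
    because the margin is nonnegative. *)
Lemma gamma_maxP x y : xi x y ->
  (exists p p', [/\ weak xi x p, xi p y, next_in xi p p'
     & maximum (gamma v xi x y) = (t p p' + m p p') / 2]) /\
  forall p p', weak xi x p -> xi p y -> next_in xi p p' ->
    (t p p' + m p p') / 2 <= maximum (gamma v xi x y).
Proof.
move=> xy; have [z xz _] := next_ex xiT xy.
pose P (p : A * A) := [/\ weak xi x p.1, xi p.1 y & next_in xi p.1 p.2].
have [|[p p'] /= [xp py pp'] H] := @finite_argmax R _ P
  (fun p => (t p.1 p.2 + m p.1 p.2) / 2).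
  by exists (x, z); split; rewrite ?weak_refl.
have E : maximum (gamma v xi x y) = (t p p' + m p p') / 2.
  apply: maximumE.
    exists p, p'; split => //=; rewrite gamma_nextE lexx andbT.
    by rewrite ler_pM2r //; have := margin_sigma_ge0 adm (next_inW pp'); rewrite /m; lra.
  move=> r [q [q' [xq qy qq']]]; rewrite gamma_nextE => /andP [_ /le_trans]; apply.
  exact: (H (q, q')).
by split; [exists p, p' | move=> q q' ? ? ?; rewrite E; apply: (H (q, q'))].
Qed.

Lemma gamma_minP x y : xi x y ->
  (exists p p', [/\ weak xi x p, xi p y, next_in xi p p'
     & minimum (gamma v xi x y) = (t p p' - m p p') / 2]) /\
  forall p p', weak xi x p -> xi p y -> next_in xi p p' ->
    minimum (gamma v xi x y) <= (t p p' - m p p') / 2.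
Proof.
move=> xy; have [z xz _] := next_ex xiT xy.
pose P (p : A * A) := [/\ weak xi x p.1, xi p.1 y & next_in xi p.1 p.2].
have [|[p p'] /= [xp py pp'] H] := @finite_argmin R _ P
  (fun p => (t p.1 p.2 - m p.1 p.2) / 2).
  by exists (x, z); split; rewrite ?weak_refl.
have E : minimum (gamma v xi x y) = (t p p' - m p p') / 2.
  apply: minimumE.
    exists p, p'; split => //=; rewrite gamma_nextE lexx /=.
    by rewrite ler_pM2r //; have := margin_sigma_ge0 adm (next_inW pp'); rewrite /m; lra.
  move=> r [q [q' [xq qy qq']]]; rewrite gamma_nextE => /andP [+ _].
  by apply: le_trans; apply: (H (q, q')).
by split; [exists p, p' | move=> q q' ? ? ?; rewrite E; apply: (H (q, q'))].
Qed.

Lemma projected_along_fst x y : xi x y ->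
  entry (projected_along v xi) x y = maximum (gamma v xi x y).
Proof. by move=> xy; rewrite entry_mk ?xy // (order_neq xiT xy). Qed.

Lemma projected_along_snd x y : xi x y ->
  entry (projected_along v xi) y x = minimum (gamma v xi x y).
Proof.
move=> xy; rewrite entry_mk ?(strict_order_asym xiT xy) //.
by rewrite eq_sym (order_neq xiT xy).
Qed.

(** The left endpoints (t - m) / 2 are nonnegative by the constraint that bounds a consecutive
    turnover below by its margin. *)
Lemma projected_along_ge0 x y : 0 <= entry (projected_along v xi) x y.
Proof.
have [->|xy] := eqVneq x y; first by rewrite entryxx.
have [[_ n _] _] := turnover_sigma_spec vL adm.
have [_ _ /(_ _ _ xy) /orP [] h] := xiT.
  rewrite projected_along_fst //.
  have [[p [p' [_ _ pp' ->]]] _] := gamma_maxP h.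
  have := n _ _ pp'; have := margin_sigma_ge0 adm (next_inW pp'); rewrite /t /m; lra.
rewrite projected_along_snd //.
have [[p [p' [_ _ pp' ->]]] _] := gamma_minP h.
have := n _ _ pp'; have := margin_sigma_ge0 adm (next_inW pp'); rewrite /t /m; lra.
Qed.

End ProjectedAlong.

(** * Limits of the projected scores along a fixed order *)

Section FixedOrderLimit.
Variables (R : realType) (A : finType) (xi : rel A) (v0 : score_family R A).
Variable G : set_system (score_family R A).
Context {GU : UltraFilter G}.
Hypotheses (Gv0 : G --> v0) (GL : G (Llull R A)) (v0L : Llull R A v0).
Hypothesis Gadm : \forall v \near G, admissible v xi.

Let adm0 : admissible v0 xi. Proof. exact: admissible_lim Gadm. Qed.
Let xiT : strict_total_order xi. Proof. by case: adm0. Qed.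

Lemma cvg_margin_sigma x y : xi x y ->
  margin_sigma v xi x y @[v --> G] --> margin_sigma v0 xi x y.
Proof.
move=> xy; apply: (@cvg_finite_min R _ G GU _
  (fun p : A * A => weak xi p.1 x /\ weak xi y p.2)
  (fun p v => margin_nu v p.1 p.2) (fun p => margin_nu v0 p.1 p.2)).
- move=> [p q] /= [px yq]; apply: cvg_margin => //; apply: (order_neq xiT).
  by apply: order_weak_trans yq => //; apply: weak_order_trans xy.
- apply: filterS Gadm => v _.
  by have [[p [q [px yq ->]]] _] := margin_sigmaP xi v x y; exists (p, q).
- apply: filterS Gadm => v _ [p q] /= [px yq].
  by have [_] := margin_sigmaP xi v x y; apply.
- by have [[p [q [px yq ->]]] _] := margin_sigmaP xi v0 x y; exists (p, q).
- by move=> [p q] /= [px yq]; have [_] := margin_sigmaP xi v0 x y; apply.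
Qed.

Lemma cvg_turnover x y : entry (turnover v) x y @[v --> G] --> entry (turnover v0) x y.
Proof.
have [->|xy] := eqVneq x y.
  by rewrite entryxx; under eq_fun do rewrite entryxx; apply: cvg_cst.
by rewrite entry_mk //; under eq_fun do rewrite entry_mk //; apply: cvgD; apply: cvg_entry.
Qed.

(* Every family feasible at v0 is approximated by families that are feasible
   for all v close to v0, by moving it slightly towards the constant 1. *)
Lemma feasible_near l tau : 0 < l <= 1 -> feasible v0 xi tau ->
  \forall v \near G, feasible v xi (convex_comb l tau (fun=> 1)).
Proof.
move=> l01 tauF.
have H : \forall v \near G, forall p : A * A, xi p.1 p.2 ->
    margin_sigma v xi p.1 p.2 <= (1 - l) * margin_sigma v0 xi p.1 p.2 + l /\
    (1 - l) * margin_sigma v0 xi p.1 p.2 <= margin_sigma v xi p.1 p.2.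
  apply: filter_forall => -[x y] /=.
  case xy: (xi x y); last by apply: filterS GL.
  have mcv := cvg_margin_sigma xy.
  have m1 := margin_sigma_le1 xi v0L (order_neq xiT xy).
  have m0 := margin_sigma_ge0 adm0 xy.
  apply: filterS2.
  - move=> v hu hl _; split; [exact: hu | exact: hl].
  (* Below 1 the bound is strict at [v0] and persists nearby; at 1 it reads
     [margin_sigma v xi x y <= 1], which every Llull matrix satisfies. *)
  - have [lt1|ge1] := ltP (margin_sigma v0 xi x y) 1.
      have h : margin_sigma v0 xi x y < (1 - l) * margin_sigma v0 xi x y + l by nra.
      by apply: filterS (cvg_lt_near mcv (cvg_cst _) h) => v /ltW.
    apply: filterS GL => v vL; have -> : margin_sigma v0 xi x y = 1 by lra.
    by have := margin_sigma_le1 xi vL (order_neq xiT xy); lra.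
  (* Likewise, when the margin at [v0] is 0, the bound reduces to nonnegativity of the margin at
     [v]. *)
  - have [gt0|le0] := ltP 0 (margin_sigma v0 xi x y).
      have h : (1 - l) * margin_sigma v0 xi x y < margin_sigma v0 xi x y by nra.
      by apply: filterS (cvg_lt_near (cvg_cst _) mcv h) => v /ltW.
    apply: filterS Gadm => v adm; have -> : margin_sigma v0 xi x y = 0 by lra.
    by rewrite mulr0 margin_sigma_ge0.
apply: filterS H => v H; have [s n d] := tauF; split.
- by move=> x y xy; rewrite !entry_conv s // !entry_cst // eq_sym.
- move=> x x' xx'; rewrite entry_conv entry_cst ?(order_neq xiT (next_inW xx')) //.
  have [] := H (x, x') (next_inW xx'); have := n _ _ xx' => /=; nra.
- move=> y y' yy' x xy xy'; rewrite !entry_conv !entry_cst //.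
  have [] := H (y, y') (next_inW yy'); have := d _ _ yy' x xy xy' => /=; nra.
Qed.

Lemma cvg_turnover_sigma x y :
  entry (turnover_sigma v xi) x y @[v --> G] --> entry (turnover_sigma v0 xi) x y.
Proof.
have Gspec : \forall v \near G, feasible v xi (turnover_sigma v xi) /\
  forall tau, feasible v xi tau ->
    sqdist (turnover_sigma v xi) (turnover v) <= sqdist tau (turnover v).
  by apply: filterS2 GL Gadm => v vL adm; exact: turnover_sigma_spec.
have [|tau tcv] := @ultra_family_cvg R A _ G (fun v => turnover_sigma v xi) 1 GU ler01.
  by apply: filterS2 Gspec Gadm => v [vF _] adm x1 y1; apply: (feasible_bounds adm).
suff -> : turnover_sigma v0 xi = tau by exact: tcv.
apply: turnover_sigmaE => //.
  apply: (feasible_lim (u := id)) (fun x y => @cvg_margin_sigma x y) _ tcv.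
  by apply: filterS Gspec => v [].
move=> tau' tauF'.
set D := sqdist tau _; set a := sqdist tau' _.
pose b := sqdist (fun=> 1) (turnover v0).
(* The competitor [tau'] need not be feasible at [v], so minimality is applied to its mixture with
   1; taking [l] small then gives D <= a. *)
have H l : 0 < l <= 1 -> D <= (1 - l) * a + l * b.
  move=> l01.
  have : D <= sqdist (convex_comb l tau' (fun=> 1)) (turnover v0).
    apply: cvg_le_lim (cvg_sqdist _ tcv cvg_turnover)
      (cvg_sqdist (f := fun=> convex_comb l tau' (fun=> 1)) _ _ cvg_turnover) _.
      by move=> x1 y1; exact: cvg_cst.
    by apply: filterS2 (feasible_near l01 tauF') Gspec => v vF [_]; apply.
  rewrite sqdist_conv -/a -/b; set S := sqdist _ _.
  have : 0 <= l * (1 - l) * S by rewrite !mulr_ge0 ?sqdist_ge0 //; lra.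
  lra.
rewrite leNgt; apply/negP => aD.
(* With l = (D - a) / B, the summand D - a ensures l <= 1, and l |b - a| < D - a contradicts the
   bound [H]. *)
pose B := `|b - a| + 1 + (D - a).
have B0 : 0 < B by rewrite /B; have := normr_ge0 (b - a); lra.
have lB : 0 < (D - a) / B <= 1.
  by rewrite divr_gt0 ?subr_gt0 //= ler_pdivrMr // /B; have := normr_ge0 (b - a); lra.
have := H _ lB; set l := (D - a) / B in lB *.
have lE : l * B = D - a by rewrite /l divfK // gt_eqF.
have : l * (b - a) <= l * `|b - a| by rewrite ler_wpM2l ?ler_norm //; lra.
move: lE; rewrite /B; nra.
Qed.

Lemma cvg_projected_along x y :
  entry (projected_along v xi) x y @[v --> G] --> entry (projected_along v0 xi) x y.
Proof.
have [->|xy] := eqVneq x y.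
  by rewrite entryxx; under eq_fun do rewrite entryxx; apply: cvg_cst.
have [_ _ /(_ _ _ xy) /orP [] {}xy] := xiT.
  apply: (@cvg_finite_max R _ G GU _
   (fun p : A * A => [/\ weak xi x p.1, xi p.1 y & next_in xi p.1 p.2])
   (fun p v => (entry (turnover_sigma v xi) p.1 p.2 + margin_sigma v xi p.1 p.2) / 2)
   (fun p => (entry (turnover_sigma v0 xi) p.1 p.2 + margin_sigma v0 xi p.1 p.2) / 2)).
  - move=> [p p'] /= [_ _ pp']; apply: cvgM; last exact: cvg_cst.
    by apply: cvgD; [exact: cvg_turnover_sigma | exact/cvg_margin_sigma/next_inW].
  - apply: filterS2 GL Gadm => v vL adm; rewrite (projected_along_fst adm) //.
    by have [[p [p' [? ? ? ->]]] _] := gamma_maxP adm xy; exists (p, p').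
  - apply: filterS2 GL Gadm => v vL adm [p p'] /= [? ? ?].
    rewrite (projected_along_fst adm) //.
    by have [_] := gamma_maxP adm xy; apply.
  - rewrite (projected_along_fst adm0) //.
    by have [[p [p' [? ? ? ->]]] _] := gamma_maxP adm0 xy; exists (p, p').
  - move=> [p p'] /= [? ? ?]; rewrite (projected_along_fst adm0) //.
    by have [_] := gamma_maxP adm0 xy; apply.
apply: (@cvg_finite_min R _ G GU _
 (fun p : A * A => [/\ weak xi y p.1, xi p.1 x & next_in xi p.1 p.2])
 (fun p v => (entry (turnover_sigma v xi) p.1 p.2 - margin_sigma v xi p.1 p.2) / 2)
 (fun p => (entry (turnover_sigma v0 xi) p.1 p.2 - margin_sigma v0 xi p.1 p.2) / 2)).
- move=> [p p'] /= [_ _ pp']; apply: cvgM; last exact: cvg_cst.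
  by apply: cvgB; [exact: cvg_turnover_sigma | exact/cvg_margin_sigma/next_inW].
- apply: filterS2 GL Gadm => v vL adm; rewrite (projected_along_snd adm) //.
  by have [[p [p' [? ? ? ->]]] _] := gamma_minP adm xy; exists (p, p').
- apply: filterS2 GL Gadm => v vL adm [p p'] /= [? ? ?].
  rewrite (projected_along_snd adm) //.
  by have [_] := gamma_minP adm xy; apply.
- rewrite (projected_along_snd adm0) //.
  by have [[p [p' [? ? ? ->]]] _] := gamma_minP adm0 xy; exists (p, p').
- move=> [p p'] /= [? ? ?]; rewrite (projected_along_snd adm0) //.
  by have [_] := gamma_minP adm0 xy; apply.
Qed.

End FixedOrderLimit.
(** * Independence of the admissible order *)

Section Swap.
Variables (A : finType) (x x' : A).

Definition swap (a : A) : A := if a == x then x' else if a == x' then x else a.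

Lemma swapL : swap x = x'. Proof. by rewrite /swap eqxx. Qed.

Lemma swapR : swap x' = x.
Proof. by rewrite /swap eqxx; case: eqP. Qed.

Lemma swapD a : a != x -> a != x' -> swap a = a.
Proof. by rewrite /swap => /negPf -> /negPf ->. Qed.

Lemma swapK : involutive swap.
Proof.
move=> a; have [->|ax] := eqVneq a x; first by rewrite swapL swapR.
have [->|ax'] := eqVneq a x'; first by rewrite swapR swapL.
by rewrite !swapD.
Qed.

Lemma swap_inj : injective swap. Proof. exact: inv_inj swapK. Qed.

End Swap.

Lemma swapC (A : finType) (x x' : A) : swap x x' =1 swap x' x.
Proof. by move=> a; rewrite /swap; case: eqP => [->|_]; case: eqP. Qed.

Definition swapped (A : finType) (xi : rel A) (x x' : A) : rel A :=
  fun a b => xi (swap x x' a) (swap x x' b).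

Section SwapOrder.
Variables (A : finType) (xi : rel A) (x x' : A).
Hypotheses (xiT : strict_total_order xi) (xx' : next_in xi x x').
Local Notation s := (swap x x').
Local Notation xi2 := (swapped xi x x').

Lemma swapped_total : strict_total_order xi2.
Proof.
have [irr tr tot] := xiT; split; first by move=> a; exact: irr.
  by move=> b a c; exact: tr.
by move=> a b ab; apply: tot; rewrite (inj_eq (@swap_inj _ x x')).
Qed.

(** Nothing lies between [x] and [x'], so any third element is on the same side of both. *)
Lemma swapped_id a b : xi a b -> ~~ ((a == x) && (b == x')) -> xi2 a b.
Proof.
move=> ab; rewrite /swapped; have lt := next_inW xx'.
have [ax|ax] := eqVneq a x; rewrite /=.
  rewrite ax in ab * => bx'; rewrite swapL swapD //; last first.
    by rewrite eq_sym (order_neq xiT).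
  have := next_in_weak xiT xx' ab.
  by rewrite /weak eq_sym (negPf bx').
move=> _; have [ax'|ax'] := eqVneq a x'.
  rewrite ax' in ab *; rewrite swapR.
  have bx : b != x.
    by apply/eqP => bx; rewrite bx (strict_order_asym xiT lt) in ab.
  have bx' : b != x' by rewrite eq_sym (order_neq xiT ab).
  by rewrite swapD //; apply: order_trans lt ab.
rewrite (swapD ax ax'); have [bx|bx] := eqVneq b x.
  by rewrite bx in ab *; rewrite swapL; apply: order_trans ab lt.
have [bx'|bx'] := eqVneq b x'; last by rewrite swapD.
rewrite bx' in ab *; rewrite swapR.
by have := prev_in_weak xiT xx' ab; rewrite /weak (negPf ax).
Qed.

Lemma next_in_swapped a b : next_in xi2 a b = next_in xi (s a) (s b).
Proof.
rewrite /next_in; congr andb; apply/forallP/forallP => H z; last exact: H.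
by have := H (s z); rewrite /swapped swapK.
Qed.

Lemma next_in_swapped_rev : next_in xi2 x' x.
Proof. by rewrite next_in_swapped swapL swapR. Qed.

End SwapOrder.

Lemma swappedK (A : finType) (xi : rel A) (x x' : A) :
  swapped (swapped xi x x') x' x = xi.
Proof.
by apply/funext => a; apply/funext => b; rewrite /swapped !(swapC x' x) !swapK.
Qed.

Lemma admissible_swapped (R : realType) (A : finType) (v : score_family R A)
    (xi : rel A) (x x' : A) : admissible v xi -> next_in xi x x' ->
  margin_nu v x x' = 0 -> admissible v (swapped xi x x').
Proof.
move=> [xiT nuxi xinu] xx' m0; apply: admissibleP; first exact: swapped_total.
move=> a b ab; apply: swapped_id => //; first exact: nuxi.
apply/negP => /andP [/eqP ax /eqP bx]; move: ab.
by rewrite ax bx /nu m0 ltxx andbF.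
Qed.

Section SwapInvariance.
Variables (R : realType) (A : finType) (v : score_family R A) (xi : rel A) (x x' : A).
Hypotheses (vL : Llull R A v) (adm : admissible v xi) (xx' : next_in xi x x').
Hypothesis m0 : margin_nu v x x' = 0.
Local Notation s := (swap x x').
Local Notation xi2 := (swapped xi x x').
Let xiT : strict_total_order xi. Proof. by case: adm. Qed.
Let adm2 : admissible v xi2. Proof. exact: admissible_swapped. Qed.

Lemma margin_sigma_swap0 : margin_sigma v xi x x' = 0.
Proof.
apply/eqP; rewrite eq_le (margin_sigma_ge0 adm (next_inW xx')) andbT -m0.
by have [_] := margin_sigmaP xi v x x'; apply; exact: weak_refl.
Qed.

(** The tie squeezes the difference between 0 and a zero margin. *)
Lemma feasible_swap0 tau y : feasible v xi tau -> y != x -> y != x' ->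
  entry tau y x = entry tau y x'.
Proof.
move=> [_ _ /(_ _ _ xx' y)]; rewrite margin_sigma_swap0 => h yx yx'.
have := h yx yx'; lra.
Qed.

Lemma feasible_swap tau a b : feasible v xi tau -> a != b ->
  entry tau (s a) (s b) = entry tau a b.
Proof.
move=> tauF; have [sym _ _] := tauF; have := order_neq xiT (next_inW xx') => nxx'.
have [->|ax] := eqVneq a x.
  rewrite swapL => xb; have [->|bx'] := eqVneq b x'; first by rewrite swapR sym // eq_sym.
  have bx : b != x by rewrite eq_sym.
  by rewrite swapD // sym 1?eq_sym // [RHS]sym // feasible_swap0.
have [->|ax'] := eqVneq a x'.
  rewrite swapR => xb; have [->|bx] := eqVneq b x; first by rewrite swapL sym.
  have bx' : b != x' by rewrite eq_sym.
  by rewrite swapD // sym 1?eq_sym // [RHS]sym // feasible_swap0.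
move=> ab; rewrite (swapD ax ax').
have [->|bx] := eqVneq b x; first by rewrite swapL feasible_swap0.
have [->|bx'] := eqVneq b x'; first by rewrite swapR feasible_swap0.
by rewrite swapD.
Qed.

(** An initial segment contains both or neither of [x] and [x'], unless it ends exactly at [x].
    Dually, a final segment is stable unless it starts at [x']. *)
Lemma weak_swap_l c p : c != x -> weak xi p c -> weak xi (s p) c.
Proof.
move=> cx; have [->|px] := eqVneq p x.
  rewrite swapL => /orP [/eqP E|xc]; first by rewrite E eqxx in cx.
  exact: next_in_weak xc.
have [->|px'] := eqVneq p x'; last by rewrite swapD.
by rewrite swapR => h; apply/orderW/(order_weak_trans xiT (next_inW xx')).
Qed.

Lemma weak_swap_r c q : c != x' -> weak xi c q -> weak xi c (s q).
Proof.
move=> cx; have [->|px'] := eqVneq q x'.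
  rewrite swapR => /orP [/eqP E|xc]; first by rewrite E eqxx in cx.
  exact: prev_in_weak xc.
have [->|px] := eqVneq q x; last by rewrite swapD.
by rewrite swapL => h; apply/orderW/(weak_order_trans xiT h)/next_inW.
Qed.

Lemma weak_swapped a b : weak xi2 a b = weak xi (s a) (s b).
Proof. by rewrite /weak (inj_eq (@swap_inj _ x x')). Qed.

(** For the tied pair both sides are 0. For every other consecutive pair, the segments that index
    the two minima are stable under the swap, so the minima run over the same pairs. *)
Lemma margin_sigma_swapped a b : next_in xi2 a b ->
  margin_sigma v xi2 a b = margin_sigma v xi (s a) (s b).
Proof.
move=> ab2; have ab := ab2; rewrite next_in_swapped in ab.
have [[p [q [px yq E]]] H] := margin_sigmaP xi v (s a) (s b).
have [[p2 [q2 [px2 yq2 E2]]] H2] := margin_sigmaP xi2 v a b.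
have [ax|ax] := eqVneq (s a) x.
  have bx : s b = x'.
    by move: ab; rewrite ax => ab; exact: (next_in_uniq xiT ab xx').
  rewrite ax bx margin_sigma_swap0; apply/eqP.
  rewrite eq_le (margin_sigma_ge0 adm2 (next_inW ab2)) andbT.
  have <- : margin_nu v x' x = 0 by rewrite margin_nuN m0 oppr0.
  by apply: H2; rewrite weak_swapped ?ax ?bx ?swapL ?swapR weak_refl.
have bx : s b != x'.
  apply: contra ax => /eqP bx; move: ab; rewrite bx => ab.
  by rewrite (prev_in_uniq xiT ab xx').
apply/eqP; rewrite eq_le; apply/andP; split.
  by rewrite E; apply: H2; rewrite weak_swapped; [exact: weak_swap_l | exact: weak_swap_r].
rewrite weak_swapped in px2; rewrite weak_swapped in yq2.
rewrite E2 -[p2](@swapK _ x x') -[q2](@swapK _ x x').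
by apply: H; [exact: weak_swap_l | exact: weak_swap_r].
Qed.

Lemma feasible_swapped tau : feasible v xi tau -> feasible v xi2 tau.
Proof.
move=> tauF; have [sym n d] := tauF; split=> //.
- move=> a b ab; rewrite margin_sigma_swapped //.
  have nab : a != b := order_neq (swapped_total x x' xiT) (next_inW ab).
  rewrite -(feasible_swap tauF nab).
  by apply: n; rewrite -next_in_swapped.
- move=> a b ab c ca cb; rewrite margin_sigma_swapped //.
  rewrite -(feasible_swap tauF ca) -(feasible_swap tauF cb).
  by apply: d; rewrite ?(inj_eq (@swap_inj _ x x')) // -next_in_swapped.
Qed.

End SwapInvariance.

Section SwapProjection.
Variables (R : realType) (A : finType) (v : score_family R A) (xi : rel A) (x x' : A).
Hypotheses (vL : Llull R A v) (adm : admissible v xi) (xx' : next_in xi x x').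
Hypothesis m0 : margin_nu v x x' = 0.
Local Notation s := (swap x x').
Local Notation xi2 := (swapped xi x x').
Let xiT : strict_total_order xi. Proof. by case: adm. Qed.
Let adm2 : admissible v xi2. Proof. exact: admissible_swapped. Qed.
Let ts := turnover_sigma v xi.
Let tsF : feasible v xi ts. Proof. by have [] := turnover_sigma_spec vL adm. Qed.
Let nxx' : x != x'. Proof. exact: (order_neq xiT (next_inW xx')). Qed.

(** The two orders have the same feasible families, hence the same minimizer; the reverse inclusion
    is the direct one applied to the swap back. *)
Lemma turnover_sigma_swapped : turnover_sigma v xi2 = ts.
Proof.
have [_ tsM] := turnover_sigma_spec vL adm.
apply: turnover_sigmaE => //; first exact: feasible_swapped.
move=> tau tauF2; apply: tsM; rewrite -(swappedK xi x x').
apply: feasible_swapped => //; first exact: next_in_swapped_rev.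
by rewrite margin_nuN m0 oppr0.
Qed.

Lemma gamma_next_swapped a b : next_in xi2 a b ->
  gamma_next v xi2 a b = gamma_next v xi (s a) (s b).
Proof.
move=> ab; rewrite /gamma_next turnover_sigma_swapped margin_sigma_swapped //.
rewrite (feasible_swap adm xx' m0 tsF) //.
exact: (order_neq (swapped_total x x' xiT) (next_inW ab)).
Qed.

Lemma gamma_swapped a b : gamma v xi2 a b = gamma v xi (s a) (s b).
Proof.
apply/seteqP; split => z [p [p' [ap pb pp' zg]]].
  exists (s p), (s p'); split => //; rewrite -?next_in_swapped -?weak_swapped //.
  by rewrite -gamma_next_swapped.
have pp2 : next_in xi2 (s p) (s p') by rewrite next_in_swapped !swapK.
exists (s p), (s p'); split => //; rewrite ?weak_swapped ?swapK //.
  by rewrite /swapped swapK.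
by rewrite gamma_next_swapped // !swapK.
Qed.

Lemma gamma_next_tie z : gamma_next v xi x x' z -> z = entry ts x x' / 2.
Proof.
rewrite gamma_nextE (margin_sigma_swap0 adm xx' m0) => h.
by have : entry ts x x' / 2 <= z <= entry ts x x' / 2; [rewrite /ts; lra | lra].
Qed.

(** The interval of the tied pair is the single point t_xx' / 2, and it already lies in the next
    interval, that of [x'] and its successor y: the constraint gives 0 <= t_xx' - t_xy <= m_x'y, and
    t_xy = t_x'y by the tie. The companion lemma uses the preceding interval. *)
Lemma gamma_tie_fst b : xi x' b -> gamma v xi x b = gamma v xi x' b.
Proof.
move=> x'b; have [sym _ d] := tsF; have lt := next_inW xx'.
apply/seteqP; split => z [p [p' [ap pb pp' zg]]]; last first.
  by exists p, p'; split => //; apply/orderW/(order_weak_trans xiT lt).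
case/orP: ap => [/eqP xp|xp]; last first.
  by exists p, p'; split => //; exact: next_in_weak xp.
have [y x'y yb] := next_ex xiT x'b.
have p'E : p' = x' by rewrite -xp in pp'; exact: (next_in_uniq xiT pp' xx').
rewrite -xp p'E in zg; have zE := gamma_next_tie zg.
have x'y' := next_inW x'y; have xy := order_trans xiT lt x'y'.
have nx'y := order_neq xiT x'y'; have nxy := order_neq xiT xy.
exists x', y; split; rewrite ?weak_refl // gamma_nextE -/ts zE.
have := d _ _ x'y x nxx' nxy.
have E : entry ts y x = entry ts y x'.
  by apply: (feasible_swap0 adm xx' m0 tsF); rewrite eq_sym.
by rewrite (sym x y) // E (sym x' y) // => h; lra.
Qed.

Lemma gamma_tie_snd b : xi b x -> gamma v xi b x = gamma v xi b x'.
Proof.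
move=> bx; have [sym _ d] := tsF; have lt := next_inW xx'.
apply/seteqP; split => z [p [p' [bp px pp' zg]]].
  by exists p, p'; split => //; apply: order_trans px lt.
have := prev_in_weak xiT xx' px.
case/orP => [/eqP pE|xp]; last by exists p, p'.
have [y yx by_] := prev_ex xiT bx.
rewrite pE in pp'.
have p'E : p' = x' by exact: (next_in_uniq xiT pp' xx').
rewrite pE p'E in zg; have zE := gamma_next_tie zg.
have yx1 := next_inW yx; have yx' := order_trans xiT yx1 lt.
have nyx := order_neq xiT yx1; have nyx' := order_neq xiT yx'.
exists y, x; split => //; rewrite gamma_nextE -/ts zE.
have x'y : x' != y by rewrite eq_sym.
have x'x : x' != x by rewrite eq_sym.
have := d _ _ yx x' x'y x'x.
have E := feasible_swap0 adm xx' m0 tsF nyx nyx'.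
by rewrite (sym x' y) // (sym x' x) // -E => h; lra.
Qed.

Let F a b := if xi a b then maximum (gamma v xi a b) else minimum (gamma v xi b a).

(** Against a third element, the degenerate interval of the tie adds nothing to the union. Between
    [x] and [x'] themselves, both scores are the midpoint t_xx' / 2. *)
Let F_swap : forall a b, a != b -> F (s a) (s b) = F a b.
Proof.
have lt := next_inW xx'; have gt := strict_order_asym xiT lt.
have Fxx' : F x x' = entry ts x x' / 2.
  rewrite /F lt; have [[p [p' [xp px' pp' ->]]] _] := gamma_maxP adm lt.
  have := prev_in_weak xiT xx' px'.
  case/orP => [/eqP pE|px]; last first.
    by have := weak_order_trans xiT xp px; rewrite order_irr.
  rewrite pE in pp' *.
  have -> : p' = x' by exact: (next_in_uniq xiT pp' xx').
  by rewrite margin_sigma_swap0 // addr0.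
have Fx'x : F x' x = entry ts x x' / 2.
  rewrite /F gt; have [[p [p' [xp px' pp' ->]]] _] := gamma_minP adm lt.
  have := prev_in_weak xiT xx' px'.
  case/orP => [/eqP pE|px]; last first.
    by have := weak_order_trans xiT xp px; rewrite order_irr.
  rewrite pE in pp' *.
  have -> : p' = x' by exact: (next_in_uniq xiT pp' xx').
  by rewrite margin_sigma_swap0 // subr0.
have [_ _ tot] := xiT.
have fwd b : b != x -> b != x' -> xi x b -> xi x' b.
  move=> bx bx' /(next_in_weak xiT xx') /orP [/eqP E|//].
  by rewrite E eqxx in bx'.
have Fl b : b != x -> b != x' -> F x b = F x' b.
  move=> bx bx'; have xb : x != b by rewrite eq_sym.
  have /orP [h|h] := tot _ _ xb.
    by rewrite /F h fwd // gamma_tie_fst // fwd.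
  have h' := order_trans xiT h lt.
  by rewrite /F (strict_order_asym xiT h) (strict_order_asym xiT h') gamma_tie_snd.
have Fr b : b != x -> b != x' -> F b x = F b x'.
  move=> bx bx'; have xb : x != b by rewrite eq_sym.
  have /orP [h|h] := tot _ _ xb.
    have h' := fwd _ bx bx' h.
    by rewrite /F (strict_order_asym xiT h) (strict_order_asym xiT h') gamma_tie_fst.
  have h' := order_trans xiT h lt.
  by rewrite /F h h' gamma_tie_snd.
move=> a b; have [->|ax] := eqVneq a x.
  rewrite swapL => xb; have [->|bx'] := eqVneq b x'; first by rewrite swapR Fxx'.
  by rewrite swapD // 1?Fl // eq_sym.
have [->|ax'] := eqVneq a x'.
  rewrite swapR => xb; have [->|bx] := eqVneq b x; first by rewrite swapL Fx'x.
  by rewrite swapD // 1?Fl // eq_sym.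
move=> ab; rewrite (swapD ax ax').
have [->|bx] := eqVneq b x; first by rewrite swapL Fr.
have [->|bx'] := eqVneq b x'; first by rewrite swapR Fr.
by rewrite swapD.
Qed.

Lemma projected_along_swapped : projected_along v xi2 = projected_along v xi.
Proof.
apply: entry_inj => a b ab; rewrite !entry_mk // !gamma_swapped.
exact: F_swap.
Qed.

End SwapProjection.

Section Independence.
Variables (R : realType) (A : finType).
Implicit Types (v : score_family R A) (xi : rel A).

(* Two admissible orders are joined by a chain of swaps of adjacent elements,
   each of which decreases the number of inversions. *)
Lemma projected_along_indep v xi xi' : Llull R A v ->
  admissible v xi -> admissible v xi' -> projected_along v xi = projected_along v xi'.
Proof.
move=> vL adm adm'; have [xiT' _ xinu'] := adm'.
pose inv (e : rel A) := [pred p : A * A | e p.1 p.2 && xi' p.2 p.1].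
have [n] := ubnP #|inv xi|; elim: n xi adm => // n IH xi adm; rewrite ltnS => invn.
have [xiT _ xinu] := adm.
have [[x x'] /andP [/= xx' x'x]|none] :=
  pickP [pred p : A * A | next_in xi p.1 p.2 && xi' p.2 p.1].
  (* Both orders are admissible and disagree on this pair, so the margin is nonnegative in both
     directions. *)
  have m0 : margin_nu v x x' = 0.
    have /xinu/andP [_ h] := next_inW xx'.
    by have /xinu'/andP [_] := x'x; rewrite margin_nuN; lra.
  rewrite -(projected_along_swapped vL adm xx' m0); apply: IH.
    exact: admissible_swapped.
  apply: leq_trans invn; apply: proper_card; apply/properP; split.
    apply/fintype.subsetP => -[a b]; rewrite !inE /= => /andP [ab ba].
    rewrite ba andbT; apply: contraT => nab.
    have abT := swapped_total x x' xiT.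
    have ba1 : xi b a.
      have [_ _ tot] := xiT; have := tot _ _ (order_neq abT ab).
      by rewrite (negPf nab).
    have : swapped xi x x' b a.
      apply: swapped_id => //; apply/negP => /andP [/eqP bx /eqP ax].
      by move: ba; rewrite bx ax (strict_order_asym xiT' x'x).
    by rewrite (strict_order_asym abT ab).
  exists (x, x'); rewrite !inE /= ?x'x ?(next_inW xx') // andbT.
  by rewrite /swapped swapL swapR (strict_order_asym xiT (next_inW xx')).
(* Agreement on consecutive pairs propagates by transitivity, and an inclusion of total orders is an
   equality. *)
have sub a b : xi a b -> xi' a b.
  have [k] := ubnP (height xi b); elim: k b => // k IHk b; rewrite ltnS => bk ab.
  have [c cb ac] := prev_ex xiT ab.
  have cb' : xi' c b.
    have [_ _ tot] := xiT'; have := tot _ _ (order_neq xiT (next_inW cb)).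
    by have := none (c, b); rewrite /= cb /= => ->; rewrite orbF.
  case/orP: ac => [/eqP -> //|ac]; apply: order_trans cb' => //.
  by apply: IHk ac; apply: leq_trans bk; apply: height_lt (next_inW cb).
congr projected_along; apply/funext => a; apply/funext => b.
case ab: (xi a b); first by rewrite sub.
apply/esym/negP => ab'; have [_ _ tot] := xiT.
have := tot _ _ (order_neq xiT' ab'); rewrite ab /= => /sub.
by rewrite (strict_order_asym xiT' ab').
Qed.

Lemma projected_scoresE v xi : Llull R A v -> admissible v xi ->
  projected_scores v = projected_along v xi.
Proof.
move=> vL adm; apply: xget_unique; first by exists xi.
by move=> w [xi' adm' ->]; exact: projected_along_indep.
Qed.

Lemma cvg_projected_scores (G : set_system (score_family R A)) (v0 : score_family R A)
    x y : UltraFilter G -> G (Llull R A) -> Llull R A v0 -> G --> v0 ->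
  entry (projected_scores v) x y @[v --> G] --> entry (projected_scores v0) x y.
Proof.
move=> GU GL v0L Gv0.
(* The orders are encoded in a finite type so that finite choice along [G] applies. *)
have Gadm : \forall v \near G, exists f : {ffun A * A -> bool},
    admissible v (fun a b => f (a, b)).
  apply: filterS GL => v _; have [xi adm] := admissible_exists v.
  exists [ffun p => xi p.1 p.2].
  by have -> : (fun a b => [ffun p => xi p.1 p.2] (a, b)) = xi
    by apply/funext => a; apply/funext => b; rewrite ffunE.
have [f adm] := @ultra_finite_choice _ G GU _ _ Gadm.
have adm0 : admissible v0 (fun a b => f (a, b)) by exact: (admissible_lim Gv0 adm).
rewrite (projected_scoresE v0L adm0).
have cvp := @cvg_projected_along R A _ v0 G GU Gv0 GL v0L adm x y.
apply: cvg_near_eq cvp.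
by apply: filterS2 GL adm => v vL admv; rewrite (projected_scoresE vL admv).
Qed.

End Independence.
(** * Zermelo's system *)

Section Ratios.
Variable R : realType.

Definition share (a b : R) : R := a / (a + b).

Lemma share_gt0 a b : 0 < a -> 0 <= b -> 0 < share a b.
Proof. by move=> a0 b0; rewrite divr_gt0 //; lra. Qed.

Lemma shareC a b : 0 < a -> 0 <= b -> share a b + share b a = 1.
Proof. by move=> a0 b0; rewrite /share; field; rewrite gt_eqF //; lra. Qed.

Lemma share_le1 a b : 0 < a -> 0 <= b -> share a b <= 1.
Proof. by move=> a0 b0; rewrite /share ler_pdivrMr; lra. Qed.

Lemma share_scale c a b : 0 < c -> share (c * a) (c * b) = share a b.
Proof.
move=> c0; have [ab0|ab0] := eqVneq (a + b) 0.
  by rewrite /share -mulrDr ab0 mulr0 !invr0 !mulr0.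
by rewrite /share -mulrDr; field; rewrite ab0 gt_eqF.
Qed.

Lemma cvg_share (T : Type) (G : set_system T) (f g : T -> R) a b : Filter G ->
  a + b != 0 -> f x @[x --> G] --> a -> g x @[x --> G] --> b ->
  share (f x) (g x) @[x --> G] --> share a b.
Proof. by move=> GF ab fa gb; apply: cvgM => //; apply: cvgV => //; exact: cvgD. Qed.

Lemma ln_sub_ge (a b : R) : 0 < a -> 0 < b -> 1 - b / a <= ln a - ln b.
Proof.
move=> a0 b0; have ab : 0 < b / a by rewrite divr_gt0.
have := expR_ge1Dx (ln (b / a)); rewrite lnK ?posrE // ln_div ?posrE //; lra.
Qed.

End Ratios.

(* For nonnegative weights that are irreducible on X, the likelihood
   prod (phi_x / (phi_x + phi_y)) ^ W_xy is maximal at a positive point, where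
   its stationarity gives the system below (Zermelo). *)
Section Zermelo.
Variables (R : realType) (A : finType) (X : {set A}) (W : A -> A -> R).
Hypotheses (W0 : forall x y, 0 <= W x y).
Hypothesis W_irreducible : forall S : {set A}, S \subset X -> S != finset.set0 ->
  S != X -> exists x y, [/\ x \in S, y \in X :\: S & 0 < W x y].
Variable f : R.
Hypotheses (f0 : 0 < f) (X0 : X != finset.set0).

(** The sums may include y = x: there the share is 1/2, and both sides receive [W x x]. *)
Definition zermelo_system (phi : A -> R) :=
  [/\ forall x, x \in X -> 0 < phi x, \sum_(x in X) phi x = f
    & forall x, x \in X -> \sum_(y in X) (W x y + W y x) * share (phi x) (phi y)
                          = \sum_(y in X) W x y].

(** Maximum principle for phi / psi. At a maximizer [a], every share under phi is at least the share
    under psi, with equality only against other maximizers; since the equations have equal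
    right-hand sides, [a] has no positive weight against a non-maximizer. Irreducibility makes the
    ratio constant, and the common sum makes it 1. *)
Lemma zermelo_uniq phi psi : zermelo_system phi -> zermelo_system psi ->
  forall x, x \in X -> phi x = psi x.
Proof.
move=> [phi0 phif phiE] [psi0 psif psiE].
have [|x xX xmax] := @finite_argmax R _ (fun x => x \in X) (fun x => phi x / psi x).
  by case/set0Pn: X0 => x xX; exists x.
have le z : z \in X -> phi z * psi x <= phi x * psi z.
  move=> zX; have := xmax _ zX.
  by rewrite ler_pdivrMr ?psi0 // mulrAC ler_pdivlMr ?psi0.
pose S := [set z in X | phi z * psi x == phi x * psi z]%SET.
have SX : S \subset X by apply/fintype.subsetP => z; rewrite inE => /andP [].
have S0 : S != finset.set0 by apply/set0Pn; exists x; rewrite inE xX /=.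
have eqS : S = X.
  apply/eqP; apply: contraT => /(W_irreducible SX S0) [a [b [aS]]].
  rewrite inE => /andP [bS bX] Wab; exfalso.
  have [aX /eqP aE] : a \in X /\ phi a * psi x == phi x * psi a.
    by move: aS; rewrite inE => /andP.
  have px := psi0 _ xX; have fx := phi0 _ xX.
  have pa := psi0 _ aX; have fa := phi0 _ aX.
  have key y : y \in X -> phi y * psi a <= phi a * psi y.
    move=> yX; have ly := le _ yX.
    rewrite -(ler_pM2r px); have -> : phi a * psi y * psi x = phi x * psi y * psi a.
      by rewrite mulrAC aE mulrAC.
    by rewrite mulrAC ler_pM2r.
  have shE y : y \in X -> share (phi a) (phi y) - share (psi a) (psi y)
     = (phi a * psi y - phi y * psi a) / ((phi a + phi y) * (psi a + psi y)).
    move=> yX; have py := psi0 _ yX; have fy := phi0 _ yX.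
    by rewrite /share; field; rewrite !gt_eqF //; lra.
  have den0 y : y \in X -> 0 < (phi a + phi y) * (psi a + psi y).
    by move=> yX; rewrite mulr_gt0 // addr_gt0 ?phi0 ?psi0.
  have sum0 : \sum_(y in X) (W a y + W y a) *
      (share (phi a) (phi y) - share (psi a) (psi y)) = 0.
    under eq_bigr do rewrite mulrBr.
    by rewrite sumrB phiE // psiE // subrr.
  have pos y : y \in X -> 0 <= (W a y + W y a) *
      (share (phi a) (phi y) - share (psi a) (psi y)).
    move=> yX; apply: mulr_ge0; first exact: addr_ge0.
    by rewrite shE // divr_ge0 ?subr_ge0 ?key // ltW ?den0.
  have /eqP := psumr_eq0P pos sum0 bX; rewrite mulf_eq0 => /orP [].
    by have := W0 b a => ? /eqP; lra.
  rewrite shE // mulf_eq0 invr_eq0 [_ == 0 in X in _ || X]gt_eqF ?den0 // orbF.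
  rewrite subr_eq0 => /eqP E; move: bS; rewrite inE bX /= => /eqP; apply.
  apply: (mulIf (lt0r_neq0 pa)); rewrite mulrAC -E mulrAC aE; ring.
have E z : z \in X -> phi z * psi x = phi x * psi z.
  by rewrite -eqS inE => /andP [_ /eqP].
have xE : phi x = psi x.
  apply/esym/(mulfI (lt0r_neq0 f0)); rewrite -{1}phif -psif mulr_suml mulr_suml.
  by apply: eq_bigr => z zX; rewrite E // mulrC.
move=> z zX; apply: (mulIf (lt0r_neq0 (psi0 _ xX))).
by rewrite E // xE mulrC.
Qed.

(** The negative log-likelihood. It depends on ratios only, so it can be minimized on the bounded
    slice where the sum is [f]. *)
Let J (phi : A -> R) :=
  \sum_(p in finset.setX X X) W p.1 p.2 * - ln (share (phi p.1) (phi p.2)).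

Let pos_on (phi : A -> R) := forall x, x \in X -> 0 < phi x.

Let term_ge0 phi (p : A * A) : pos_on phi -> p \in finset.setX X X ->
  0 <= W p.1 p.2 * - ln (share (phi p.1) (phi p.2)).
Proof.
move=> phi0; rewrite inE => /andP [p1 p2]; rewrite mulr_ge0 // oppr_ge0 ln_le0 //.
by rewrite share_le1 ?phi0 // ltW ?phi0.
Qed.

Let normalize (phi : A -> R) : A -> R := fun x => f / (\sum_(y in X) phi y) * phi x.

Let sum_gt0 phi : pos_on phi -> 0 < \sum_(y in X) phi y.
Proof.
move=> phi0; case/set0Pn: X0 => x xX; rewrite (bigD1 x) //=.
by rewrite ltr_wpDr ?phi0 // sumr_ge0 // => y /andP [yX _]; rewrite ltW ?phi0.
Qed.

Let normalize_pos phi : pos_on phi -> pos_on (normalize phi).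
Proof. by move=> phi0 x xX; rewrite mulr_gt0 ?phi0 // divr_gt0 ?sum_gt0. Qed.

Let normalize_sum phi : pos_on phi -> \sum_(x in X) normalize phi x = f.
Proof. by move=> phi0; rewrite -mulr_sumr divfK // gt_eqF ?sum_gt0. Qed.

Let J_normalize phi : pos_on phi -> J (normalize phi) = J phi.
Proof.
move=> phi0; apply: eq_bigr => p _; rewrite share_scale //.
by rewrite divr_gt0 ?sum_gt0.
Qed.

(* If some phi_x tended to 0, then, by irreducibility, so would some share with
   positive weight, and the likelihood would not stay bounded away from 0. *)
Let likelihood_max : exists2 phi, pos_on phi & forall psi, pos_on psi -> J phi <= J psi.
Proof.
pose u := normalize (fun=> 1).
have u0 : pos_on u by apply: normalize_pos => x _.
have [||l [l0 lf lu] lmin] := @ultra_argmin R (A -> R)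
  [set phi | [/\ pos_on phi, \sum_(x in X) phi x = f & J phi <= J u]] J.
- by exists u; split => //; apply: normalize_sum => x _.
- move=> G GU GD.
  have bnd x : x \in X -> \forall phi \near G, 0 <= (phi : A -> R) x <= f.
    move=> xX; apply: filterS GD => phi [phi0 phif _]; rewrite ltW ?phi0 //=.
    rewrite -phif (bigD1 x) //= lerDl sumr_ge0 // => y /andP [yX _].
    by rewrite ltW ?phi0.
  have H x : exists l : R, x \in X -> 0 <= l /\ (phi : A -> R) x @[phi --> G] --> l.
    case xX: (x \in X); last by exists (0 : R).
    have [l /andP [l0 _] cl] := ultra_bounded_cvg (bnd _ xX).
    by exists l.
  pose l x : R := projT1 (cid (H x)).
  have lP x : x \in X -> 0 <= l x /\ (phi : A -> R) x @[phi --> G] --> l x.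
    by rewrite /l; case: (cid (H x)).
  have lf : \sum_(x in X) l x = f.
    apply: (@cvg_eq_lim R _ G _ (fun phi : A -> R => \sum_(x in X) phi x) (fun=> f)).
    - by apply: cvg_bigsum => x /lP [].
    - exact: cvg_cst.
    - by apply: filterS GD => phi [].
  have lpos : pos_on l.
    pose S := [set x in X | l x == 0]%SET.
    have SX : S \subset X by apply/fintype.subsetP => z; rewrite inE => /andP [].
    suff S0 : S = finset.set0.
      move=> x xX; rewrite lt0r (proj1 (lP _ xX)) andbT; apply/negP => lx.
      by have : x \in S; [rewrite inE xX | rewrite S0 inE].
    apply/eqP; apply: contraT => S0.
    have SnX : S != X.
      apply/eqP => E; have : \sum_(x in X) l x = 0.
        by apply: big1 => x; rewrite -E inE => /andP [_ /eqP].
      by rewrite lf => fE; move: f0; rewrite fE ltxx.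
    have [a [b [aS]]] := W_irreducible SX S0 SnX.
    rewrite inE => /andP [bS bX] Wab.
    have [aX /eqP la] : a \in X /\ l a == 0 by move: aS; rewrite inE => /andP.
    have lb : 0 < l b.
      rewrite lt0r (proj1 (lP _ bX)) andbT; apply/negP => lb.
      by move: bS; rewrite inE bX lb.
    (* All terms of [J] are nonnegative, so [J phi <= J u] bounds the single term of (a, b) and
       keeps its share above [d]. In the limit d (l a + l b) <= l a, impossible when l a = 0 < l
       b. *)
    pose d := expR (- (J u / W a b)).
    have near : \forall phi \near G, d * (phi a + phi b) <= (phi : A -> R) a.
      apply: filterS GD => phi [phi0 _ Ju].
      have pa := phi0 _ aX; have pb := phi0 _ bX.
      have sh0 : 0 < share (phi a) (phi b) by rewrite share_gt0 // ltW.
      have : W a b * - ln (share (phi a) (phi b)) <= J u.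
        apply: le_trans Ju; rewrite /J (bigD1 (a, b)) /=; last by rewrite inE /= aX.
        by rewrite lerDl sumr_ge0 // => p /andP [pX _]; exact: term_ge0.
      rewrite mulrC -ler_pdivlMr // lerNl => h.
      have : d <= share (phi a) (phi b).
        by rewrite -(@lnK _ (share _ _)) ?posrE // ler_expR.
      by rewrite /share ler_pdivlMr // addr_gt0.
    have cva : (phi : A -> R) a @[phi --> G] --> l a by have [] := lP _ aX.
    have cvb : (phi : A -> R) b @[phi --> G] --> l b by have [] := lP _ bX.
    have : d * (l a + l b) <= l a.
      by apply: cvg_le_lim (cvgM (cvg_cst d) (cvgD cva cvb)) cva near.
    have := mulr_gt0 (expR_gt0 (- (J u / W a b))) lb; rewrite -/d la add0r; lra.
  have Jl : J phi @[phi --> G] --> J l.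
    apply: cvg_bigsum => -[x y]; rewrite inE /= => /andP [xX yX].
    apply: cvgM; first exact: cvg_cst.
    apply: cvgN; apply: (@cvg_comp _ _ _ (fun phi : A -> R => share (phi x) (phi y))
       (@ln R) G (nbhs (share (l x) (l y)))).
      have [_ lx] := lP _ xX; have [_ ly] := lP _ yX.
      by apply: cvg_share => //; rewrite gt_eqF // addr_gt0 ?lpos.
    by apply: continuous_ln; rewrite share_gt0 ?lpos // ltW ?lpos.
  exists l => //; split => //.
  by apply: cvg_le_lim Jl (cvg_cst (J u)) _; apply: filterS GD => phi [].
- exists l => // psi psi0; have [h|h] := leP (J psi) (J u); last first.
    by apply: le_trans lu (ltW h).
  rewrite -(J_normalize psi0); apply: lmin; split.
  + exact: normalize_pos.
  + exact: normalize_sum.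
  + by rewrite J_normalize.
Qed.

Lemma zermelo_exists : exists phi, zermelo_system phi.
Proof.
have [l l0 lmin] := likelihood_max.
suff H x : x \in X -> \sum_(y in X) (W x y + W y x) * share (l x) (l y)
    = \sum_(y in X) W x y.
  exists (normalize l); split; [exact: normalize_pos|exact: normalize_sum|].
  move=> x xX; rewrite -H //; apply: eq_bigr => y yX.
  by rewrite share_scale // divr_gt0 ?sum_gt0.
move=> xX.
pose p y := share (l x) (l y).
have pb y : y \in X -> 0 < p y <= 1.
  by move=> yX; rewrite share_gt0 ?share_le1 ?l0 // ltW ?l0.
(* Only the entry of x is multiplied by 1 + h; then ln z <= z - 1. *)
have var h : -1 < h -> \sum_(y in X | y != x)
    (W x y * (h * (1 - p y) / (1 + h)) - W y x * (h * p y)) <= 0.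
  move=> h1; pose psi z := if z == x then (1 + h) * l x else l z.
  have psi0 : pos_on psi.
    by move=> z zX; rewrite /psi; case: eqP => _; rewrite ?mulr_gt0 ?l0 //; lra.
  have := lmin _ psi0; rewrite -subr_ge0 /J -sumrB => dJ.
  pose c (q : A * A) := W q.1 q.2 *
    (1 - share (l q.1) (l q.2) / share (psi q.1) (psi q.2)).
  have : \sum_(q in finset.setX X X) c q <= 0.
    rewrite -oppr_ge0 -sumrN; apply: le_trans dJ _; apply: ler_sum => q.
    rewrite inE => /andP [q1 q2]; rewrite /c -mulrBr -mulrN ler_wpM2l //.
    have sl : 0 < share (l q.1) (l q.2) by rewrite share_gt0 ?l0 // ltW ?l0.
    have sp : 0 < share (psi q.1) (psi q.2) by rewrite share_gt0 ?psi0 // ltW ?psi0.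
    have := ln_sub_ge sp sl; lra.
  suff -> : \sum_(q in finset.setX X X) c q = \sum_(y in X | y != x)
    (W x y * (h * (1 - p y) / (1 + h)) - W y x * (h * p y)) by [].
  rewrite (eq_bigl (fun q => (q.1 \in X) && (q.2 \in X))); last by move=> q; rewrite inE.
  rewrite -(pair_big (fun a => a \in X) (fun b => b \in X) (fun a b => c (a, b))) /=.
  have psx : psi x = (1 + h) * l x by rewrite /psi eqxx.
  have psD z : z != x -> psi z = l z by rewrite /psi => /negPf ->.
  have czz z : z \in X -> c (z, z) = 0.
    move=> zX; rewrite /c /= /share; have := l0 _ zX; have := psi0 _ zX => ? ?.
    by field; rewrite !gt_eqF //; lra.
  have cne a b : a \in X -> b \in X -> a != x -> b != x -> c (a, b) = 0.
    move=> aX bX ax bx; rewrite /c /= !psD // divff ?subrr ?mulr0 //.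
    by rewrite gt_eqF // share_gt0 ?l0 // ltW ?l0.
  rewrite (bigD1 x) //= (bigD1 x) //= czz // add0r.
  rewrite [X in _ + X](eq_bigr (fun a => c (a, x))); last first.
    move=> a /andP [aX ax]; rewrite (bigD1 x) //= big1 ?addr0 // => b /andP [bX bx].
    exact: cne.
  rewrite -big_split /=; apply: eq_bigr => y /andP [yX yx].
  rewrite /c /= psx psD // /p /share; have lx := l0 _ xX; have ly := l0 _ yX.
  have hx : 0 < 1 + h by lra.
  have hlx : 0 < (1 + h) * l x by rewrite mulr_gt0.
  by field; rewrite !gt_eqF //; lra.
(* The equation of the system at [x] is exactly a = b, once the diagonal terms are removed. *)
pose a := \sum_(y in X | y != x) W x y * (1 - p y).
pose b := \sum_(y in X | y != x) W y x * p y.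
have var' h : -1 < h -> h * (a - (1 + h) * b) <= 0.
  move=> h1; have h1' : 0 < 1 + h by lra.
  have := var _ h1; rewrite sumrB.
  have -> : \sum_(y in X | y != x) W x y * (h * (1 - p y) / (1 + h)) = h / (1 + h) * a.
    by rewrite mulr_sumr; apply: eq_bigr => y _; field; rewrite gt_eqF.
  have -> : \sum_(y in X | y != x) W y x * (h * p y) = h * b.
    by rewrite mulr_sumr; apply: eq_bigr => y _; ring.
  move=> H; have := ler_wpM2l (ltW h1') H; rewrite mulr0.
  suff -> : (1 + h) * (h / (1 + h) * a - h * b) = h * (a - (1 + h) * b) by [].
  by field; rewrite gt_eqF.
have b0 : 0 <= b.
  by apply: sumr_ge0 => y /andP [yX _]; rewrite mulr_ge0 //; have /andP [/ltW] := pb _ yX.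
have ab : a = b.
  apply/eqP; rewrite eq_le; apply/andP; split; rewrite leNgt; apply/negP => lt.
    (* This [h] has the sign of a - b and is small enough that a - (1 + h) b keeps that sign, so the
       product in [var'] is positive. The same formula serves below, where a >= 0 ensures h > -1. *)
    pose h := (a - b) / (2 * (b + 1)).
    have h0 : 0 < h by rewrite divr_gt0 //; lra.
    have hE : h * (2 * (b + 1)) = a - b by rewrite divfK // gt_eqF //; lra.
    have h1 : -1 < h by lra.
    by have := var' _ h1; rewrite leNgt mulr_gt0 //; nra.
  pose h := - ((b - a) / (2 * (b + 1))).
  have h0 : 0 < - h by rewrite opprK divr_gt0 //; lra.
  have hE : h * (2 * (b + 1)) = a - b.
    by rewrite mulNr divfK ?opprB // gt_eqF //; lra.
  have a0 : 0 <= a.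
    apply: sumr_ge0 => y /andP [yX _]; rewrite mulr_ge0 //.
    by have /andP [_] := pb _ yX; lra.
  have h1 : -1 < h by nra.
  by have := var' _ h1; rewrite leNgt nmulr_rgt0; nra.
rewrite [LHS](bigD1 x) // [RHS](bigD1 x) //=; congr (_ + _).
  by rewrite /share; field; rewrite gt_eqF // addr_gt0 ?l0.
apply/eqP; rewrite -subr_eq0 -sumrB; apply/eqP.
rewrite -[RHS](subrr a) {1}ab /a /b -sumrB.
by apply: eq_bigr => y _; rewrite -/(p y); ring.
Qed.

End Zermelo.
(** * Fraction-like rates *)

Section FractionSystem.
Variables (R : realType) (A : finType).
Implicit Types (w : score_family R A) (X : {set A}).

(** That the exit point [b] still reaches [u] is what later confines [b] to a set closed under
    predecessors. *)
Lemma connect_exit (e : rel A) (S : {set A}) s u : connect e s u ->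
  s \in S -> u \notin S -> exists a b, [/\ a \in S, b \notin S, e a b & connect e b u].
Proof.
move=> /connectP [p]; elim: p s => [|b p IH] s /=.
  by move=> _ -> sS; rewrite sS.
move=> /andP [sb pb] uE sS uS; have [bS|bS] := boolP (b \in S).
  exact: (IH b).
by exists s, b; split => //; apply/connectP; exists p.
Qed.

Lemma top_componentE w X : top_dominant w X -> top_component w = X.
Proof.
have sub (Y Z : {set A}) : top_dominant w Y -> top_dominant w Z -> Y \subset Z.
  move=> [_ Yin Yout Ynot] [/set0Pn [z zZ] _ Zout Znot].
  apply/fintype.subsetP => y yY; apply: contraT => yZ.
  have [zY|zY] := boolP (z \in Y).
    have yz : y != z by apply: contraNneq yZ => ->.
    by have := Znot _ _ zZ yZ; rewrite Yin.
  by have := Znot _ _ zZ yZ; rewrite Yout.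
move=> XT; apply: xget_unique => // Y YT; apply/eqP.
by rewrite finset.eqEsubset !sub.
Qed.

Lemma top_dominant_connect w X : top_dominant w X ->
  forall x y, x \in X -> joined w x y.
Proof.
move=> [_ Xin Xout _] x y xX; have [yX|/(Xout _ _ xX)//] := boolP (y \in X).
by have [->|xy] := eqVneq x y; [exact: connect0 | exact: Xin].
Qed.

Lemma top_dominant_pred w X : top_dominant w X -> (forall x y, 0 <= entry w x y) ->
  forall x y, x \in X -> y \notin X -> entry w y x = 0.
Proof.
move=> [_ _ _ Xnot] w0 x y xX yX; apply/eqP; rewrite eq_le w0 andbT leNgt.
apply: contra (Xnot _ _ xX yX) => yx; exact: connect1.
Qed.

(** Since [x] reaches everything, the elements that reach [x] form the top component. *)
Lemma top_dominant_exists w x :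
  (forall y, y != x -> 0 < entry w x y) -> exists X, top_dominant w X.
Proof.
move=> xpos; have xto y : joined w x y.
  by have [->|yx] := eqVneq y x; [exact: connect0 | exact/connect1/xpos].
exists [set y | joined w y x]%SET; split.
- by apply/set0Pn; exists x; rewrite inE; exact: connect0.
- by move=> y z; rewrite !inE => yx _ _; apply: connect_trans yx (xto z).
- by move=> y z; rewrite !inE => yx _; apply: connect_trans yx (xto z).
- by move=> y z; rewrite !inE => yx; apply: contra => zy; apply: connect_trans zy yx.
Qed.

Lemma top_dominant_irreducible w X : top_dominant w X ->
  (forall x y, 0 <= entry w x y) ->
  forall S : {set A}, S \subset X -> S != finset.set0 -> S != X ->
  exists x y, [/\ x \in S, y \in X :\: S & 0 < entry w x y].
Proof.
move=> XT w0 S SX /set0Pn [s sS] SnX.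
have [u uX uS] : exists2 u, u \in X & u \notin S.
  by apply/fintype.subsetPn; apply: contra SnX => XS; rewrite finset.eqEsubset SX.
have su := top_dominant_connect XT u (fintype.subsetP SX _ sS).
have [a [b [aS bS ab bu]]] := connect_exit su sS uS.
exists a, b; split => //; rewrite inE bS /=; apply: contraT => bX.
by have [_ _ _ /(_ _ _ uX bX)] := XT; rewrite /joined bu.
Qed.

Lemma entry_turnover w x y : entry (turnover w) x y = entry w x y + entry w y x.
Proof.
have [->|xy] := eqVneq x y; first by rewrite !entryxx addr0.
by rewrite entry_mk.
Qed.

Lemma fraction_systemP w X f phi : top_dominant w X ->
  fraction_system w f phi <->
  (forall x, x \notin X -> phi x = 0) /\ zermelo_system X (entry w) f phi.
Proof.
move=> XT; rewrite /fraction_system (top_componentE XT).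
have E1 x : x \in X -> \sum_(y in X) (entry w x y + entry w y x) * share (phi x) (phi y)
    = \sum_(y in X | y != x) entry (turnover w) x y * (phi x / (phi x + phi y)).
  move=> xX; rewrite (bigD1 x) //= entryxx addr0 mul0r add0r.
  by apply: eq_bigr => y _; rewrite entry_turnover.
have E2 x : x \in X -> \sum_(y in X) entry w x y = \sum_(y in X | y != x) entry w x y.
  by move=> xX; rewrite (bigD1 x) //= entryxx add0r.
split=> [[phi0 phip phif phiE]|[phi0 [phip phif phiE]]].
  by split => //; split => // x xX; rewrite E1 // E2 // phiE.
by split => // x xX; rewrite -E1 // -E2 // phiE.
Qed.

Lemma fraction_rate_spec (v : score_family R A) X f : 0 < f ->
  top_dominant (projected_scores v) X ->
  (forall x y, 0 <= entry (projected_scores v) x y) ->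
  fraction_system (projected_scores v) f (fraction_rate f v).
Proof.
move=> f0 XT w0; have irr := top_dominant_irreducible XT w0.
have [Xn0 _ _ _] := XT.
have [phi [phip phif phiE]] := zermelo_exists w0 irr f0 Xn0.
rewrite /fraction_rate; case: xgetP => [psi _ //|].
move=> /(_ (fun x => if x \in X then phi x else 0)) []; apply/(fraction_systemP _ _ XT).
split; first by move=> x /negPf ->.
split.
- by move=> x xX; rewrite xX phip.
- by rewrite -phif; apply: eq_bigr => x ->.
- by move=> x xX; rewrite -phiE // xX; apply: eq_bigr => y ->.
Qed.

Lemma fraction_system_uniq w X f phi psi : 0 < f -> top_dominant w X ->
  (forall x y, 0 <= entry w x y) ->
  fraction_system w f phi -> fraction_system w f psi -> phi = psi.
Proof.
move=> f0 XT w0 /(fraction_systemP _ _ XT) [phi0 phiZ].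
move=> /(fraction_systemP _ _ XT) [psi0 psiZ]; apply/funext => x.
have [xX|xX] := boolP (x \in X); last by rewrite phi0 // psi0.
have [Xn0 _ _ _] := XT.
exact: (zermelo_uniq w0 (top_dominant_irreducible XT w0) f0 Xn0 phiZ psiZ).
Qed.

Lemma sum_subset (S X : {set A}) (F : A -> R) : S \subset X ->
  \sum_(y in X) F y = \sum_(y in S) F y + \sum_(y in X :\: S) F y.
Proof.
move=> /fintype.subsetP SX; rewrite (bigID (fun y => y \in S)) /=; congr (_ + _).
  by apply: eq_bigl => y; apply/andP/idP => [[]//|yS]; split => //; exact: SX.
by apply: eq_bigl => y; rewrite inE andbC.
Qed.

(* Summing the equations over S, the terms internal to S cancel. *)
Lemma zermelo_balance (W : A -> A -> R) X (S : {set A}) f phi :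
  zermelo_system X W f phi -> S \subset X ->
  \sum_(x in S) \sum_(y in X :\: S) W y x * share (phi x) (phi y)
  = \sum_(x in S) \sum_(y in X :\: S) W x y * share (phi y) (phi x).
Proof.
move=> [phip _ phiE] SX.
have SXP x : x \in S -> x \in X := fintype.subsetP SX x.
have sC x y : x \in X -> y \in X -> share (phi y) (phi x) = 1 - share (phi x) (phi y).
  move=> xX yX; rewrite -(@shareC _ (phi x) (phi y)) ?phip //; first by ring.
  by rewrite ltW ?phip.
have tot : \sum_(x in S) \sum_(y in X) ((W x y + W y x) * share (phi x) (phi y) - W x y) = 0.
  by apply: big1 => x xS; rewrite sumrB phiE ?subrr // SXP.
have ins : \sum_(x in S) \sum_(y in S) ((W x y + W y x) * share (phi x) (phi y) - W x y) = 0.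
  have -> : \sum_(x in S) \sum_(y in S) ((W x y + W y x) * share (phi x) (phi y) - W x y)
    = \sum_(x in S) \sum_(y in S) W y x * share (phi x) (phi y)
      - \sum_(x in S) \sum_(y in S) W x y * share (phi y) (phi x).
    rewrite -sumrB; apply: eq_bigr => x xS; rewrite -sumrB; apply: eq_bigr => y yS.
    by rewrite (sC x y) ?SXP //; ring.
  by rewrite [X in X - _]exchange_big subrr.
apply/eqP; rewrite -subr_eq0 -sumrB; apply/eqP.
move: tot; rewrite (eq_bigr _ (fun x _ => sum_subset _ SX)) big_split /= ins add0r.
move=> tot1; rewrite -[RHS]tot1.
apply: eq_bigr => x xS; rewrite -sumrB.
apply: eq_bigr => y; rewrite inE => /andP [_ yX].
by rewrite (sC x y) //; [ring | exact: SXP].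
Qed.

End FractionSystem.

(** * Limits of solutions of the fraction systems *)

Section FractionLimit.
Variables (R : realType) (A : finType) (T : Type) (G : set_system T).
Context {GU : UltraFilter G}.
Variables (w : T -> score_family R A) (w0 : score_family R A) (X0 : {set A}).
Variables (f : R) (phi : T -> A -> R) (phi0 : A -> R).
Hypothesis f0 : 0 < f.
Hypothesis wcv : forall x y, entry (w t) x y @[t --> G] --> entry w0 x y.
Hypothesis w0ge0 : forall x y, 0 <= entry w0 x y.
Hypothesis X0T : top_dominant w0 X0.
Hypothesis phi0S : fraction_system w0 f phi0.
Hypothesis nearT : \forall t \near G, [/\ forall x y, 0 <= entry (w t) x y,
  exists X, top_dominant (w t) X & fraction_system (w t) f (phi t)].

(* Let l be the limit of phi and U its support. The balance over U shows that,
   at the limit, no score leads into U from outside, so that X0 <= U; then the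
   balance over X0 shows that no score leads from X0 to U :\: X0, so U = X0. *)
Lemma cvg_fraction_system x0 : phi t x0 @[t --> G] --> phi0 x0.
Proof.
have [X nearX] : exists X, \forall t \near G, [/\ top_dominant (w t) X,
    forall x y, 0 <= entry (w t) x y, forall x, x \notin X -> phi t x = 0
  & zermelo_system X (entry (w t)) f (phi t)].
  apply: (@ultra_finite_choice _ G GU); apply: filterS nearT => t [wge [X XT] phiS].
  by exists X; have [] := proj1 (fraction_systemP f (phi t) XT) phiS.
have nearZ : \forall t \near G, zermelo_system X (entry (w t)) f (phi t).
  by apply: filterS nearX => t [].
have H x : exists2 l : R, 0 <= l & phi t x @[t --> G] --> l.
  have [|l /andP [l0 _] cl] := @ultra_bounded_cvg R _ G GU (phi ^~ x) 0 f; last by exists l.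
  apply: filterS nearX => t [_ _ phi0' [phip phif _]].
  have [xX|/phi0' ->] := boolP (x \in X); last by rewrite lexx ltW.
  rewrite ltW ?phip //= -phif (bigD1 x) //= lerDl sumr_ge0 // => y /andP [yX _].
  by rewrite ltW ?phip.
pose l x : R := projT1 (cid2 (H x)).
have l0 x : 0 <= l x by rewrite /l; case: (cid2 (H x)).
have lcv x : phi t x @[t --> G] --> l x by rewrite /l; case: (cid2 (H x)).
suff lS : fraction_system w0 f l.
  by rewrite (fraction_system_uniq f0 X0T w0ge0 phi0S lS).
have lf : \sum_(x in X) l x = f.
  apply: (@cvg_eq_lim R _ G _ (fun t => \sum_(x in X) phi t x) (fun=> f)).
  - by apply: cvg_bigsum.
  - exact: cvg_cst.
  - by apply: filterS nearZ => t [].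
have lX x : x \notin X -> l x = 0.
  move=> xX; apply: (@cvg_eq_lim R _ G _ (fun t => phi t x) (fun=> 0)) => //.
    exact: cvg_cst.
  by apply: filterS nearX => t [_ _ -> //].
have wX x y : x \in X -> y \notin X -> entry w0 y x = 0.
  move=> xX yX.
  apply: (@cvg_eq_lim R _ G _ (fun t => entry (w t) y x) (fun=> 0)) => //.
    exact: cvg_cst.
  by apply: filterS nearX => t [XT wge _ _]; apply: (top_dominant_pred XT).
pose U := [set x | 0 < l x]%SET.
have UP x : (x \in U) = (0 < l x) by rewrite inE.
have UX : U \subset X.
  apply/fintype.subsetP => x; rewrite UP; apply: contraTT => /lX ->.
  by rewrite ltxx.
have lU x : x \notin U -> l x = 0.
  by rewrite UP -leNgt => h; apply/eqP; rewrite eq_le h l0.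
(* One argument must lie in the support, to stay away from the singularity at (0, 0). *)
have shcv x y : x \in U -> share (phi t x) (phi t y) @[t --> G] --> share (l x) (l y).
  by rewrite UP => lx; apply: cvg_share => //; rewrite gt_eqF // ltr_wpDr.
have shcv' x y : x \in U -> share (phi t y) (phi t x) @[t --> G] --> share (l y) (l x).
  by rewrite UP => lx; apply: cvg_share => //; rewrite gt_eqF // ltr_wpDl.
have balance (S : {set A}) : S \subset U ->
    \sum_(x in S) \sum_(y in X :\: S) entry w0 y x * share (l x) (l y)
    = \sum_(x in S) \sum_(y in X :\: S) entry w0 x y * share (l y) (l x).
  move=> SU; apply: (@cvg_eq_lim R _ G _
    (fun t => \sum_(x in S) \sum_(y in X :\: S)
       entry (w t) y x * share (phi t x) (phi t y))
    (fun t => \sum_(x in S) \sum_(y in X :\: S)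
       entry (w t) x y * share (phi t y) (phi t x))).
  - apply: cvg_bigsum => x xS; apply: cvg_bigsum => y _; apply: cvgM => //.
    by apply: shcv; apply: (fintype.subsetP SU).
  - apply: cvg_bigsum => x xS; apply: cvg_bigsum => y _; apply: cvgM => //.
    by apply: shcv'; apply: (fintype.subsetP SU).
  - apply: filterS nearZ => t Z; apply: zermelo_balance Z _.
    exact: fintype.subset_trans SU UX.
have share_l x y : x \in U -> y \notin U -> share (l x) (l y) = 1.
  by rewrite UP => lx /lU ->; rewrite /share addr0 divff // gt_eqF.
have share_r x y : x \in U -> y \notin U -> share (l y) (l x) = 0.
  by move=> _ /lU ->; rewrite /share mul0r.
have UE x y : x \in U -> y \notin U -> entry w0 y x = 0.
  move=> xU yU; have [yX|yX] := boolP (y \in X); last first.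
    by apply: wX => //; apply: (fintype.subsetP UX).
  have := balance U (fintype.subxx _); rewrite [RHS]big1; last first.
    move=> a aU; apply: big1 => b; rewrite inE => /andP [bU _].
    by rewrite share_r // mulr0.
  have pos a : a \in U -> 0 <= \sum_(b in X :\: U) entry w0 b a * share (l a) (l b).
    move=> aU; apply: sumr_ge0 => b; rewrite inE => /andP [bU _].
    by rewrite share_l // mulr1.
  move=> /(psumr_eq0P pos) /(_ _ xU) sx.
  have posx b : b \in X :\: U -> 0 <= entry w0 b x * share (l x) (l b).
    by rewrite inE => /andP [bU _]; rewrite share_l // mulr1.
  have := psumr_eq0P posx sx (i := y); rewrite inE yU yX share_l // mulr1; exact.
have Upred a b : joined w0 a b -> b \in U -> a \in U.
  move=> /connectP [p]; elim: p a => [|c p IH] a /=; first by move=> _ ->.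
  move=> /andP [ac cp] bE bU; have cU := IH c cp bE bU.
  by apply: contraT => aU; rewrite (UE _ _ cU aU) ltxx in ac.
have [u uU] : exists u, u \in U.
  have [//|none] := pselect (exists u, u \in U).
  have : \sum_(x in X) l x = 0.
    by apply: big1 => x _; apply: lU; apply/negP => xU; apply: none; exists x.
  by rewrite lf => fE; move: f0; rewrite fE ltxx.
have X0U : X0 \subset U.
  by apply/fintype.subsetP => x xX0; apply: Upred uU; apply: (top_dominant_connect X0T).
have X0E := top_dominant_pred X0T w0ge0.
have X0bal x y : x \in X0 -> y \in U -> y \notin X0 -> entry w0 x y = 0.
  move=> xX0 yU yX0.
  have := balance X0 X0U; rewrite [LHS]big1; last first.
    move=> a aX; apply: big1 => b; rewrite inE => /andP [bX _].
    by rewrite X0E // mul0r.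
  have term a b : a \in X0 -> 0 <= entry w0 a b * share (l b) (l a).
    by move=> aX; rewrite mulr_ge0 // divr_ge0 // addr_ge0.
  have pos a : a \in X0 -> 0 <= \sum_(b in X :\: X0) entry w0 a b * share (l b) (l a).
    by move=> aX; apply: sumr_ge0 => b _; apply: term.
  move=> /esym/(psumr_eq0P pos) /(_ _ xX0) sx.
  have := psumr_eq0P (fun b _ => term x b xX0) sx (i := y).
  rewrite inE yX0 (fintype.subsetP UX) // => /(_ isT) /eqP; rewrite mulf_eq0.
  have shy : 0 < share (l y) (l x) by rewrite share_gt0 // -UP.
  by rewrite (gt_eqF shy) orbF => /eqP.
have UX0 : U = X0.
  (* A path from [X0] to an element of [U] outside [X0] would leave [X0] at some [b] that still
     reaches [U], hence lies in [U], against [X0bal]. *)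
  apply/eqP; rewrite finset.eqEsubset X0U andbT; apply/fintype.subsetP => y yU.
  apply: contraT => yX0; have [/set0Pn [x xX0] _ _ _] := X0T.
  have xy := top_dominant_connect X0T y xX0.
  have [a [b [aX bX ab b_y]]] := connect_exit xy xX0 yX0.
  by rewrite X0bal ?ltxx ?(Upred _ _ b_y) in ab.
have X0X : X0 \subset X by rewrite -UX0.
apply/(fraction_systemP _ _ X0T); split; first by move=> x; rewrite -UX0; apply: lU.
split.
- by move=> x; rewrite -UX0 UP.
- rewrite -lf (sum_subset _ X0X) [X in _ + X]big1 ?addr0 // => y.
  by rewrite inE -UX0 => /andP [/lU].
(* The equations near the limit sum over [X], the limit system over [X0]. The extra terms agree on
   both sides: the shares there are 1, and no score leads into [X0]. *)
- move=> x xX0; apply: (@addIr _ (\sum_(y in X :\: X0) entry w0 x y)).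
  rewrite -(sum_subset _ X0X).
  have -> : \sum_(y in X :\: X0) entry w0 x y =
    \sum_(y in X :\: X0) (entry w0 x y + entry w0 y x) * share (l x) (l y).
    apply: eq_bigr => y; rewrite inE => /andP [yX0 _].
    by rewrite share_l ?UX0 // mulr1 (X0E x y) // addr0.
  rewrite -(sum_subset _ X0X).
  apply: (@cvg_eq_lim R _ G _
    (fun t => \sum_(y in X) (entry (w t) x y + entry (w t) y x) *
       share (phi t x) (phi t y)) (fun t => \sum_(y in X) entry (w t) x y)).
  + apply: cvg_bigsum => y _; apply: cvgM; first exact: cvgD.
    by apply: shcv; rewrite UX0.
  + by apply: cvg_bigsum.
  + apply: filterS nearZ => t [_ _]; apply.
    exact: (fintype.subsetP X0X).
Qed.

End FractionLimit.

(** * Positivity of the projected scores of a nonzero matrix *)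

Section NonzeroScores.
Variables (R : realType) (A : finType) (v : score_family R A).
Hypothesis vL : Llull R A v.

Lemma projected_scores_ge0 x y : 0 <= entry (projected_scores v) x y.
Proof.
have [xi adm] := admissible_exists v.
by rewrite (projected_scoresE vL adm) projected_along_ge0.
Qed.

Lemma turnover_bounds p : 0 <= turnover v p <= 1.
Proof.
rewrite entry_val entry_turnover; have [h1 ->] := vL (valP p); rewrite andbT.
have nqp : (val p).2 != (val p).1 by rewrite eq_sym (valP p).
by have [h2 _] := vL nqp; lra.
Qed.

(* If all the projected turnovers vanished, then so would the margins, every
   constant in [0, 1] would be feasible, and the mean turnover would do better. *)
Lemma turnover_sigma_neq0 xi : admissible v xi -> v <> (fun=> 0) ->
  turnover_sigma v xi <> (fun=> 0).
Proof.
move=> adm vn0 ts0; have [xiT _ _] := adm.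
have [[_ n _] tsM] := turnover_sigma_spec vL adm.
have m0 x x' : next_in xi x x' -> margin_sigma v xi x x' = 0.
  move=> xx'; have xy := order_neq xiT (next_inW xx').
  have := n _ _ xx'; rewrite ts0 entry_cst // => /andP [h _].
  by apply/eqP; rewrite eq_le h (margin_sigma_ge0 adm (next_inW xx')).
pose S := \sum_p turnover v p.
pose N : R := #|{: pairs A}|%:R.
have S0 : 0 <= S by apply: sumr_ge0 => p _; case/andP: (turnover_bounds p).
have SN : S <= N.
  rewrite /N -sumr_const; apply: ler_sum => p _; by case/andP: (turnover_bounds p).
have Sn0 : S != 0.
  apply/eqP => SE; apply: vn0.
  have t0 p : turnover v p = 0.
    apply: (psumr_eq0P _ SE) => // q _; by case/andP: (turnover_bounds q).
  apply/funext => p; have := t0 p; rewrite [v p]entry_val entry_val entry_turnover.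
  have [/andP [h1 _] _] := vL (valP p).
  have nqp : (val p).2 != (val p).1 by rewrite eq_sym (valP p).
  by have [/andP [h2 _] _] := vL nqp; lra.
have Spos : 0 < S by rewrite lt0r Sn0.
have Npos : 0 < N by lra.
have c01 : 0 < S / N <= 1 by rewrite divr_gt0 //= ler_pdivrMr // mul1r.
have cF : feasible v xi (fun=> S / N).
  split.
  - by move=> x y xy; rewrite !entry_cst // eq_sym.
  - move=> x x' xx'; rewrite m0 // entry_cst ?(order_neq xiT (next_inW xx')) //.
    by move: c01 => /andP [/ltW -> ->].
  - by move=> y y' yy' x xy xy'; rewrite !entry_cst // subrr m0 ?lexx.
have := tsM _ cF; rewrite ts0 -subr_ge0 /sqdist -sumrB.
have -> : \sum_p ((S / N - turnover v p) ^+ 2 - (0 - turnover v p) ^+ 2)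
  = N * (S / N) ^+ 2 - 2 * (S / N) * S.
  rewrite (eq_bigr (fun p => (S / N) ^+ 2 - 2 * (S / N) * turnover v p)); last first.
    by move=> p _; ring.
  rewrite sumrB sumr_const -mulr_sumr -/S -[X in X - _ = _]mulr_natl.
  by congr (_%:R * _ - _); exact: eq_card.
have -> : N * (S / N) ^+ 2 - 2 * (S / N) * S = - (S / N * S).
  by field; rewrite gt_eqF.
by rewrite oppr_ge0 leNgt mulr_gt0 //; case/andP: c01.
Qed.

(** Take [x] first in the order, with successor x'. By monotonicity t_xx' is the largest projected
    turnover, so it is positive, as otherwise all would vanish. Every interval union starting at [x]
    contains that of xx', whose right endpoint is at least t_xx' / 2. *)
Lemma first_row_gt0 : v <> (fun=> 0) ->
  exists x, forall y, y != x -> 0 < entry (projected_scores v) x y.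
Proof.
move=> vn0; have [xi adm] := admissible_exists v; have [xiT _ _] := adm.
have [p _] : exists p : pairs A, True.
  apply: contrapT => noP; apply: vn0; apply/funext => p.
  by case: noP; exists p.
case: (@arg_minnP _ (val p).1 xpredT (height xi)) => // x _ xmin.
have xfst y : y != x -> xi x y.
  move=> yx; have [_ _ /(_ _ _ yx) /orP [h|//]] := xiT.
  by have := xmin y isT; rewrite leqNgt height_lt.
have wfst a : weak xi x a.
  by rewrite /weak; have [->|/xfst ->] := eqVneq a x; rewrite ?eqxx ?orbT.
exists x => y yx; have xy := xfst _ yx.
rewrite (projected_scoresE vL adm) (projected_along_fst adm) //.
have [x' xx' _] := next_ex xiT xy.
have [_ gmax] := gamma_maxP adm xy.
apply: lt_le_trans (gmax _ _ (weak_refl xi x) xy xx').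
have [tsF _] := turnover_sigma_spec vL adm.
have m0 := margin_sigma_ge0 adm (next_inW xx').
rewrite divr_gt0 // ltr_wpDr // ltNge; apply/negP => t0.
apply: (turnover_sigma_neq0 adm vn0); apply: entry_inj => a b ab.
rewrite entry_cst //.
wlog : a b ab / xi a b.
  move=> H; have [_ _ /(_ _ _ ab) /orP [|] h] := xiT; first exact: H.
  by have [s _ _] := tsF; rewrite s // H // eq_sym.
move=> xiab.
have xb : xi x b := weak_order_trans xiT (wfst a) xiab.
apply/eqP; rewrite eq_le; have /andP [-> _] := feasible_bounds adm tsF ab.
rewrite andbT; apply: le_trans t0.
apply: le_trans (feasible_mono_l adm tsF (wfst a) xiab) _.
by apply: (feasible_mono_r adm tsF (next_inW xx')); exact: next_in_weak xb.
Qed.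

End NonzeroScores.

(** * Continuity of the projected scores and of both rates *)

Theorem theorem13p1 (R : realType) (A : finType) (cardA : (2 <= #|A|)%N) :
  [/\ forall p : pairs A,
        {within Llull R A, continuous (fun v => projected_scores v p)},
      forall x : A,
        {within Llull R A, continuous (fun v => rank_rate v x)}
    & forall f : R, 0 < f <= 1 -> forall x : A,
        {within Llull R A `\ (fun=> 0 : R),
          continuous (fun v => fraction_rate f v x)}].
Proof.
split.
- move=> p.
  have -> : (fun v : score_family R A => projected_scores v p) =
      (fun v => entry (projected_scores v) (val p).1 (val p).2).
    by apply/funext => v; rewrite [LHS]entry_val.
  apply: within_continuous_ultra => G v0 GU GL v0L Gv0.
  exact: cvg_projected_scores.
- move=> x; apply: within_continuous_ultra => G v0 GU GL v0L Gv0.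
  apply: cvgB; first exact: cvg_cst.
  by apply: cvg_bigsum => y _; apply: cvg_projected_scores.
- move=> f /andP [f0 _] x.
  apply: within_continuous_ultra => G v0 GU GD [v0L v00] Gv0.
  have GL : G (Llull R A) by apply: filterS GD => v [].
  have spec v : (Llull R A `\ (fun=> 0 : R)) v ->
      exists2 X, top_dominant (projected_scores v) X
      & fraction_system (projected_scores v) f (fraction_rate f v).
    move=> [vL vn0]; have [y ypos] := first_row_gt0 vL vn0.
    have [X XT] := top_dominant_exists ypos; exists X => //.
    by apply: fraction_rate_spec XT _ => // a b; exact: projected_scores_ge0.
  have [X0 X0T phi0S] := spec v0 (conj v0L v00).
  apply: (cvg_fraction_system (w := @projected_scores R A) (phi := @fraction_rate R A f)
    f0 _ _ X0T phi0S).
  + by move=> a b; apply: cvg_projected_scores.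
  + by move=> a b; exact: projected_scores_ge0.
  + apply: filterS GD => v vD; have [X XT phiS] := spec v vD.
    split => //; last by exists X.
    by move=> a b; apply: projected_scores_ge0; case: vD.
Qed.
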